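(* Let $\Gamma$ be a finite simple graph without loops, and let $n,m$ be positive integers. Then the discretized configuration space $\mathrm{Conf}^{\,\square}_n(\Gamma)$ is a closed $m$-pseudomanifold if and only if at least one of the following is true. (1) $\Gamma$ is a finite disjoint union of cycles, $n \in \{1, |V(\Gamma)|-1\}$, and $m=1$. (2) $\Gamma \cong K_{2m+1}$ and $n \in \{m, m+1\}$. (3) $\Gamma \cong K_{m+1,m+1}$ and $n \in \{m, m+2\}$. (4) $\Gamma \cong K_{m,m+2}$ and $n = m+1$. (5) $\Gamma \cong K_p \sqcup K_q$ for some odd positive integers $p$ and $q$ satisfying $p+q = 2m+2$, and $n = m+1$.
   Context: $|\Gamma|$ is the geometric realization of $\Gamma$, viewed as a 1-dimensional cell complex whose cells are the vertices and (closed) edges. $\mathrm{Conf}^{\,\square}_n(\Gamma)$, the $n$-point (ordered) discretized configuration space, is the subcomplex of the cubical complex $|\Gamma|^n$ obtained by removing every product cell $e_1\times\cdots\times e_n$ (each $e_i$ a vertex or edge of $\Gamma$) such that $\partial e_i\cap\partial e_j\neq\emptyset$ for some $i\ne j$, where the boundary of a vertex is read as the vertex itself and that of an edge is its set of two endpoints. Equivalently, it is the union of all products $e_1\times\cdots\times e_n$ of pairwise disjoint closed cells of $\Gamma$; the dimension of such a cube is the number of $e_i$ that are edges. A finite $m$-dimensional cubical complex $X$ is a closed $m$-pseudomanifold if every $(m-1)$-cell of $X$ is a face of exactly two $m$-dimensional cells ($m$-dimensional means that it has at least one $m$-cell and no cell of larger dimension). $K_r$ is the complete graph on $r$ vertices,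 $K_{a,b}$ the complete bipartite graph with parts of sizes $a,b$, and $\sqcup$ is disjoint union. A finite disjoint union of cycles means a disjoint union of one or more cycle graphs (each of length at least 3). *)

(* Defs.v *)
From mathcomp Require Import all_boot.

Set Implicit Arguments.
Unset Strict Implicit.
Unset Printing Implicit Defensive.

(* A finite simple graph is a symmetric irreflexive relation on a finType. *)

Definition graph_iso (T1 T2 : finType) (e1 : rel T1) (e2 : rel T2) : Prop :=
  exists2 f : T1 -> T2, bijective f & forall x y, e2 (f x) (f y) = e1 x y.

Definition complete_graph (r : nat) : rel 'I_r := fun x y => x != y.

Definition complete_bipartite (a b : nat) : rel ('I_a + 'I_b) :=
  fun u v => match u, v with
             | inl _, inr _ | inr _, inl _ => true
             | _, _ => false
             end.

Definition disjoint_union (T1 T2 : finType) (e1 : rel T1) (e2 : rel T2) :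
    rel (T1 + T2) :=
  fun u v => match u, v with
             | inl x, inl y => e1 x y
             | inr x, inr y => e2 x y
             | _, _ => false
             end.

Definition big_disjoint_union (I : finType) (T_ : I -> finType)
    (e_ : forall i, rel (T_ i)) : rel {i : I & T_ i} :=
  fun u v => (tag u == tag v) && e_ (tag u) (tagged u) (tagged_as u v).

(* ordS is the successor modulo l. *)
Definition cycle_graph (l : nat) : rel 'I_l :=
  fun x y => (ordS x == y) || (ordS y == x).

Definition is_union_of_cycles (T : finType) (e : rel T) : Prop :=
  exists (k : nat) (l : 'I_k -> nat),
    [/\ 0 < k, forall i, 3 <= l i
      & graph_iso e (big_disjoint_union (fun i => @cycle_graph (l i)))].

(* A finite cell complex is given by the set X of its closed cells, their      *)
(* dimensions, and the relation "face c d" (c is a face of d).                 *)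
Definition closed_pseudomanifold (C : finType) (dim : C -> nat) (face : rel C)
    (X : {set C}) (m : nat) : Prop :=
  [/\ exists2 c, c \in X & dim c = m,
      forall c, c \in X -> dim c <= m
    & forall c, c \in X -> (dim c).+1 = m ->
        #|[set d in X | (dim d == m) && face c d]| = 2].

Section DiscretizedConfigurationSpace.
Variables (T : finType) (e : rel T) (n : nat).

(* A closed cell of |G| is encoded by its set of vertices: a singleton for a   *)
(* vertex, the pair of endpoints for an edge. In both cases this set is also   *)
(* the boundary of the cell, the boundary of a vertex being itself.            *)
Definition vertex_cells : {set {set T}} := [set [set x] | x : T].

Definition edge_cells : {set {set T}} :=
  [set [set p.1; p.2] | p : T * T & e p.1 p.2].

Definition graph_cells : {set {set T}} := vertex_cells :|: edge_cells.

(* The product cell c 0 x ... x c (n-1) of |G|^n. *)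
Definition cube : finType := {ffun 'I_n -> {set T}}.

Definition cube_dim (c : cube) : nat := #|[set i | c i \in edge_cells]|.

(* The faces of a product cell are the products of faces of its factors. *)
Definition cube_face (c d : cube) : bool := [forall i, c i \subset d i].

Definition power_cells : {set cube} :=
  [set c : cube | [forall i, c i \in graph_cells]].

Definition discretized_conf : {set cube} :=
  power_cells :\:
    [set c : cube | [exists i, exists j, (i != j) && (c i :&: c j != set0)]].

Definition conf_closed_pseudomanifold (m : nat) : Prop :=
  closed_pseudomanifold cube_dim cube_face discretized_conf m.

End DiscretizedConfigurationSpace.

(* Main.v *)
Require Import Defs.
From mathcomp Require Import all_boot zify.

Set Implicit Arguments.
Unset Strict Implicit.
Unset Printing Implicit Defensive.

(** A cube of dimension d is a matching of d edges together with a set S of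
    n - d occupied vertices off the matching, and one passes to a cube of the next
    dimension by joining an occupied vertex to a free one. The condition on the
    (m - 1)-cubes therefore reads as follows (conf_pseudomanifoldP): if A is what
    is left of the vertex set after deleting the ends of m - 1 disjoint edges,
    then every subset S of A with s = n - m + 1 elements is joined to its
    complement in A by exactly two edges.

    If s or #|A| - s is 1, this says that A is two-regular. Otherwise, comparing
    the subsets S which differ by an exchange of elements shows that A is edgeless,
    complete, a star, or a complete graph with an isolated vertex added, and
    counting edges leaves the star K_(1,3) and the triangle with an isolated
    vertex (balanced_single_edge). These are the graphs on four vertices in
    which each of the three pairings contains exactly one edge.

    It remains to recover the graph from these residues. The tool is the parity
    of the number of edges in a triple of vertices: a graph is complete
    bipartite (with a part that may be empty) if and only if all parities are
    even, and it is a disjoint union of two complete graphs if and only if they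
    are all odd. Such a condition on the graph can be verified after deleting an
    edge which avoids the triple, so an induction on m applies. As soon as an
    edge is deleted, two-regular residues lead to a complete graph or to even
    parities (residues_two_regular). For the residues on four vertices the
    parity turns out not to change when a vertex of the triple is replaced, so
    it is constant (residues_single_edge_quad, quad_even_or_odd). The sizes of
    the parts are then read off from the degrees.

    When m = 1 no edge is deleted and the graph itself may be two-regular. It is a
    union of cycles because walking along a cycle never reverses an edge
    (iter_turn_reverse), which allows all cycles to be oriented at once.

    Conversely, in the graphs of the list every residue is determined by the sizes
    of its colour classes: deleting an edge of a complete bipartite graph removes
    one vertex from each class, and deleting an edge of a union of two
    complete graphs preserves the parity of both classes. The number of edges
    leaving S is then computed class by class (cut_colored). *)

(** Adjacency is determined by the colours of the two ends. With r always true
    this is a complete graph, with r the exclusive or a complete bipartite graph, and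
    with r the equality a disjoint union of two complete graphs. *)
Definition colored (T : finType) (r : bool -> bool -> bool) (e : rel T) (B : {set T}) :=
  forall x y, e x y = (x != y) && r (x \in B) (y \in B).

(** * Matchings and what they leave *)

Section Graph.
Variables (T : finType) (e : rel T).
Hypotheses (e_sym : symmetric e) (e_irr : irreflexive e).
Implicit Types (A B S U : {set T}).

(** The matching deleted from A is kept implicit, since only the set B of vertices
    which it leaves matters. *)
Fixpoint residue k A B : Prop :=
  if k is k'.+1 then
    exists x y, [/\ x \in A, y \in A, e x y & residue k' (A :\ x :\ y) B]
  else A = B.

Definition has_matching k A := exists B, residue k A B.

Definition residues_are k A (P : {set T} -> Prop) :=
  has_matching k A /\ forall B, residue k A B -> P B.

Definition deg A v := \sum_(w in A) e v w.
Definition cut S U := \sum_(v in S) deg U v.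

Lemma edge_neq x y : e x y -> x != y.
Proof. by apply: contraTneq => ->; rewrite e_irr. Qed.

Lemma card_del_edge A x y : x \in A -> y \in A -> e x y ->
  #|A| = #|A :\ x :\ y| + 2.
Proof.
move=> xA yA exy; rewrite (cardsD1 x A) xA (cardsD1 y (A :\ x)) !inE yA.
by rewrite eq_sym (edge_neq exy); lia.
Qed.

Lemma residue_card k A B : residue k A B -> #|A| = #|B| + 2 * k.
Proof.
elim: k A => [|k IH] A /=; first by move=> ->; lia.
by move=> [x [y [xA yA exy /IH]]]; rewrite (card_del_edge xA yA exy); lia.
Qed.

(** The definition of residue peels off the first edge of the matching; the two
    following lemmas give access to the last one. *)
Lemma residue_rcons k A B x y : residue k A B ->
  x \in B -> y \in B -> e x y -> residue k.+1 A (B :\ x :\ y).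
Proof.
elim: k A => [|k IH] A /=; first by move=> -> xB yB exy; exists x, y.
move=> [a [b [aA bA eab r]]] xB yB exy; exists a, b; split=> //.
exact: (IH _ r).
Qed.

Lemma residue_last k A C : residue k.+1 A C ->
  exists B x y, [/\ residue k A B, x \in B, y \in B, e x y & C = B :\ x :\ y].
Proof.
elim: k A => [|k IH] A.
  by move=> [x [y [xA yA exy /= <-]]]; exists A, x, y.
move=> [a [b [aA bA eab /IH]]] [B [x [y [r xB yB exy CE]]]].
by exists B, x, y; split=> //; exists a, b.
Qed.

Lemma has_matchingS k A : has_matching k.+1 A <->
  exists x y, [/\ x \in A, y \in A, e x y & has_matching k (A :\ x :\ y)].
Proof.
split=> [[B [x [y [xA yA exy r]]]]|[x [y [xA yA exy [B r]]]]].
  by exists x, y; split=> //; exists B.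
by exists B, x, y.
Qed.

Lemma has_matching_sub k A A' : A \subset A' ->
  has_matching k A -> has_matching k A'.
Proof.
elim: k A A' => [|k IH] A A' sAA'; first by exists A'.
move=> /has_matchingS[x [y [xA yA exy r]]]; apply/has_matchingS.
exists x, y; split=> //; try exact: (subsetP sAA').
by apply: IH r; rewrite !setSD.
Qed.

(** Deleting a vertex destroys at most one edge of a matching. *)
Lemma has_matchingD1 k A v : has_matching k.+1 A -> has_matching k (A :\ v).
Proof.
elim: k A => [|k IH] A; first by exists (A :\ v).
move=> /has_matchingS[x [y [xA yA exy r]]].
have [vxy|vxy] := boolP (v \in [set x; y]).
  apply: has_matching_sub r; apply/subsetP=> z.
  move: vxy; rewrite !inE => /orP[]/eqP-> /and3P[? ? ?]; exact/andP.
move: vxy; rewrite !inE negb_or => /andP[vx vy].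
apply/has_matchingS; exists x, y; split=> //.
- by rewrite !inE eq_sym vx.
- by rewrite !inE eq_sym vy.
apply: has_matching_sub (IH _ r); apply/subsetP=> z.
by rewrite !inE => /and4P[-> -> -> ->].
Qed.

Lemma has_matchingW k A : has_matching k.+1 A -> has_matching k A.
Proof.
move=> /has_matchingS[x [y [_ _ _]]]; apply: has_matching_sub.
exact: subset_trans (subD1set _ _) (subD1set _ _).
Qed.

Lemma has_matching_le j k A : j <= k -> has_matching k A -> has_matching j A.
Proof.
elim: k => [|k IH]; first by rewrite leqn0 => /eqP->.
by rewrite leq_eqVlt => /predU1P[->//|jk] /has_matchingW/(IH jk).
Qed.

Lemma has_matching1 A : has_matching 1 A <->
  exists x y, [/\ x \in A, y \in A & e x y].
Proof.
split=> [/has_matchingS[x [y [xA yA exy _]]]|[x [y [xA yA exy]]]].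
  by exists x, y.
by apply/has_matchingS; exists x, y; split=> //; exists (A :\ x :\ y).
Qed.

Lemma has_matching_ext k A B : residue k A B -> has_matching 1 B ->
  has_matching k.+1 A.
Proof.
move=> r /has_matching1[x [y [xB yB exy]]].
by exists (B :\ x :\ y); apply: residue_rcons.
Qed.

(** Since the residues still contain an edge, A contains k + 2 disjoint edges, so an
    arbitrary edge can be completed to a matching of k + 1 edges. *)
Lemma residues_are_edge k A P x y : (forall B, P B -> has_matching 1 B) ->
  residues_are k.+1 A P -> x \in A -> y \in A -> e x y ->
  residues_are k (A :\ x :\ y) P.
Proof.
move=> Pedge [[B r] AP] xA yA exy; split.
  by do 2!apply: has_matchingD1; apply: has_matching_ext r (Pedge _ (AP _ r)).
by move=> C rC; apply: AP; exists x, y.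
Qed.

Lemma residues_are_matching k A P : (forall B, P B -> has_matching 1 B) ->
  residues_are k A P -> has_matching k.+1 A.
Proof. by move=> Pedge [[B r] AP]; apply: has_matching_ext r (Pedge _ (AP _ r)). Qed.

Lemma degD1 A x v : x \in A -> deg A v = e v x + deg (A :\ x) v.
Proof. by move=> xA; rewrite /deg (big_setD1 x). Qed.

Lemma deg_edge A x y v : x \in A -> y \in A -> e x y ->
  deg A v = e v x + e v y + deg (A :\ x :\ y) v.
Proof.
move=> xA yA exy; rewrite (degD1 _ xA) (@degD1 _ y) ?addnA //.
by rewrite !inE yA eq_sym (edge_neq exy).
Qed.

Lemma deg_le_card A v : deg A v <= #|A|.
Proof. by rewrite /deg -sum1_card; apply: leq_sum => w _; apply: leq_b1. Qed.

Lemma deg_card A v : deg A v = #|[set w in A | e v w]|.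
Proof.
rewrite /deg -sum1_card [RHS]big_mkcond [LHS]big_mkcond /=; apply: eq_bigr => w _.
by rewrite inE; case: (w \in A); case: (e v w).
Qed.

Lemma deg_gt0P A v : 0 < deg A v -> exists2 w, w \in A & e v w.
Proof.
rewrite /deg => d0; apply/exists_inP; move: d0; apply: contraTT.
rewrite negb_exists_in => /forall_inP H; rewrite -leqNgt leqn0.
by apply/eqP; apply: big1 => w /H; case: (e v w).
Qed.

Lemma deg_nonedge A v w : v \in A -> w \in A -> v != w -> ~~ e v w ->
  deg A v + 2 <= #|A|.
Proof.
move=> vA wA vw nvw; rewrite (degD1 _ vA) e_irr (@degD1 _ w) ?inE ?wA 1?eq_sym ?vw //.
rewrite (negbTE nvw) (cardsD1 v A) vA (cardsD1 w (A :\ v)) !inE wA eq_sym vw.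
by have := deg_le_card (A :\ v :\ w) v; lia.
Qed.

Lemma deg_full A v : v \in A -> (forall w, w \in A -> w != v -> e v w) ->
  #|A| = (deg A v).+1.
Proof.
move=> vA full; rewrite (degD1 _ vA) e_irr (cardsD1 v A) vA /deg -sum1_card.
congr _.+1; apply: eq_bigr => w; rewrite !inE => /andP[wv wA].
by rewrite full.
Qed.

Lemma cutC S U : cut S U = cut U S.
Proof.
rewrite /cut /deg exchange_big /=; apply: eq_bigr => x _; apply: eq_bigr => y _.
by rewrite e_sym.
Qed.

Lemma cutDl S U x : x \in S -> cut S U = deg U x + cut (S :\ x) U.
Proof. by move=> xS; rewrite /cut (big_setD1 x). Qed.

(** * Graphs with two-regular residues *)

Definition clique A := {in A &, forall x y, x != y -> e x y}.
Definition regular d A := {in A, forall v, deg A v = d}.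
(** Both sides agree when the triple x, y, z spans an even number of edges;
    triples with a repetition satisfy this in any graph. *)
Definition even_triples A := {in A & &, forall x y z, e x y = e z x (+) e z y}.

Definition two_regular A := A != set0 /\ regular 2 A.

Lemma two_regular_edge A : two_regular A -> has_matching 1 A.
Proof.
move=> [/set0Pn[v vA] reg]; apply/has_matching1.
have [|w wA evw] := @deg_gt0P A v; first by rewrite reg.
by exists v, w.
Qed.

(** In an edge v w every vertex is adjacent to exactly one end, so the degrees
    of v and w add up to the number of vertices. *)
Lemma even_regular_card A d v : even_triples A -> regular d A -> 0 < d ->
  v \in A -> #|A| = 2 * d.
Proof.
move=> ev reg d0 vA; have [|w wA evw] := @deg_gt0P A v; first by rewrite reg.
rewrite mul2n -addnn -{1}(reg v vA) -(reg w wA) /deg -big_split -sum1_card /=.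
apply: eq_bigr => z zA; have := ev _ _ _ vA wA zA.
by rewrite evw ![e z _]e_sym; case: (e v z); case: (e w z).
Qed.

(** A triple without edges is even, so only triples containing an edge matter. *)
Lemma even_triples_of_edges A :
  (forall a b c, a \in A -> b \in A -> c \in A -> c != a -> c != b -> e a b ->
    e c a (+) e c b) -> even_triples A.
Proof.
move=> H x y z xA yA zA.
have [->|xy] := eqVneq x y; first by rewrite e_irr addbb.
have [->|zx] := eqVneq z x; first by rewrite e_irr.
have [->|zy] := eqVneq z y; first by rewrite e_irr addbF e_sym.
have [/H->//|nxy] := boolP (e x y).
have [ezx|nzx] := boolP (e z x).
  have := H z x y zA xA yA; rewrite ![y == _]eq_sym zy xy ezx => /(_ isT isT isT).
  by rewrite ![e y _]e_sym (negbTE nxy) addbF => ->.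
have [ezy|//] := boolP (e z y).
have := H z y x zA yA xA; rewrite ![x == _]eq_sym zx eq_sym xy ezy => /(_ isT isT isT).
by rewrite ![e x _]e_sym (negbTE nzx) e_sym (negbTE nxy).
Qed.

(** Deleting an edge removes at most two neighbours of a vertex off it, so all
    degrees are 2, 3 or 4. Degree 2 is impossible because a neighbour of such a
    vertex has another neighbour, and the edge between them is off the vertex.
    A vertex of degree 4 is adjacent to both ends of every edge off it, which
    forces five mutually adjacent vertices. If all degrees are 3, then every edge
    off a vertex has exactly one end adjacent to it. *)
Lemma residue1_two_regular A : residues_are 1 A two_regular ->
  clique A /\ #|A| = 5 \/ even_triples A /\ regular 3 A.
Proof.
move=> QA.
have Q x y : x \in A -> y \in A -> e x y -> two_regular (A :\ x :\ y).
  move=> xA yA exy.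
  have [_] := residues_are_edge two_regular_edge QA xA yA exy.
  exact.
have F x y z : x \in A -> y \in A -> e x y -> z \in A -> z != x -> z != y ->
    deg A z = 2 + e z x + e z y.
  move=> xA yA exy zA zx zy; rewrite (deg_edge _ xA yA exy).
  by case: (Q _ _ xA yA exy) => _ ->; [lia|rewrite !inE zx zy].
have avoid z : exists x y, [/\ x \in A, y \in A, e x y, z != x & z != y].
  have /has_matching1[x [y [xA yA exy]]] : has_matching 1 (A :\ z).
    exact: has_matchingD1 (residues_are_matching two_regular_edge QA).
  move: xA yA; rewrite !inE => /andP[xz xA] /andP[yz yA].
  by exists x, y; rewrite ![z == _]eq_sym.
have deg2 z : z \in A -> 2 <= deg A z <= 4.
  move=> zA; have [x [y [xA yA exy zx zy]]] := avoid z.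
  by rewrite (F _ _ _ xA yA exy zA zx zy); lia.
have other v z : v \in A -> z \in A -> exists w, [/\ w \in A, w != z & e v w].
  move=> vA zA; have [|w] := @deg_gt0P (A :\ z) v.
    by have := deg2 v vA; rewrite (degD1 _ zA); lia.
  by rewrite !inE => /andP[wz wA] evw; exists w.
have deg3 z : z \in A -> 3 <= deg A z.
  move=> zA; have [|w wA ezw] := @deg_gt0P A z; first by have := deg2 z zA; lia.
  have [w' [w'A w'z eww']] := other w z wA zA.
  rewrite (F _ _ _ wA w'A eww' zA) ?ezw; [lia|exact: edge_neq|by rewrite eq_sym].
have [/exists_inP[z zA /eqP z4]|] := boolP [exists z in A, deg A z == 4].
  left; have ez v : v \in A -> v != z -> e z v.
    move=> vA vz; have [w [wA wz evw]] := other v z vA zA.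
    have := F _ _ _ vA wA evw zA; rewrite z4 ![z == _]eq_sym => /(_ vz wz).
    by case: (e z v); case: (e z w).
  have A5 : #|A| = 5 by rewrite (deg_full zA ez) z4.
  split=> // u v uA vA uv; have [uz|uz] := eqVneq u z; first by rewrite uz ez // -uz eq_sym.
  have [->|vz] := eqVneq v z; first by rewrite e_sym ez.
  have /card_gt0P[w] : 0 < #|A :\ z :\ u :\ v|.
    have := cardsD1 z A; have := cardsD1 u (A :\ z); have := cardsD1 v (A :\ z :\ u).
    by rewrite A5; clear; do 3!case: (_ \in _); lia.
  rewrite !inE => /and4P[wv wu wz wA]; apply/negPn/negP => nuv.
  have ezw := ez w wA wz; have [_ reg] := Q _ _ zA wA ezw.
  have uA' : u \in A :\ z :\ w by rewrite !inE uz uA eq_sym wu.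
  have vA' : v \in A :\ z :\ w by rewrite !inE vz vA eq_sym wv.
  have := leq_trans (deg_nonedge uA' vA' uv nuv) (leqnn _); rewrite (reg u uA').
  have := card_del_edge zA wA ezw; rewrite A5 -[5]/(3 + 2) => /eqP.
  by rewrite eqn_add2r => /eqP<-.
rewrite negb_exists_in => /forall_inP n4; right.
have reg3 : regular 3 A.
  by move=> z zA; have := deg3 z zA; have := deg2 z zA; have := n4 z zA; lia.
split=> //; apply: even_triples_of_edges => a b c aA bA cA ca cb eab.
have := F _ _ _ aA bA eab cA ca cb.
by rewrite reg3 //; case: (e c a); case: (e c b).
Qed.

(** Induction on the size of the matching. The parity of #|A| decides which
    alternative occurs, the same one for all deleted edges. An edge avoiding a
    given pair exists because A contains three disjoint edges; an edge avoiding a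
    given triple is needed only if the triple contains an edge, and then it
    is found among what that edge leaves. *)
Theorem residues_two_regular k A : residues_are k.+1 A two_regular ->
  clique A /\ #|A| = 2 * k + 5 \/ even_triples A /\ regular (k + 3) A.
Proof.
elim: k A => [|k IH] A QA; first exact: residue1_two_regular.
have Q x y xA yA exy := IH _ (@residues_are_edge _ _ _ x y two_regular_edge QA xA yA exy).
have match3 : has_matching 3 A.
  exact: has_matching_le (residues_are_matching two_regular_edge QA).
have avoid u v : exists x y, [/\ x \in A, y \in A, e x y
    & ((u != x) && (u != y)) && ((v != x) && (v != y))].
  have /has_matching1[x [y [xA yA exy]]] : has_matching 1 (A :\ u :\ v).
    by do 2!apply: has_matchingD1.
  move: xA yA; rewrite !inE => /and3P[xv xu xA] /and3P[yv yu yA].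
  by exists x, y; split=> //; rewrite ![u == _]eq_sym ![v == _]eq_sym xv xu yv yu.
have [x0 [y0 [x0A y0A e0]]] : exists x y, [/\ x \in A, y \in A & e x y].
  by apply/has_matching1; apply: has_matching_le match3.
have cardA := card_del_edge x0A y0A e0.
have [[_ c0]|[ev0 reg0]] := Q _ _ x0A y0A e0.
  left; split; last by rewrite cardA c0; clear; lia.
  move=> u v uA vA uv; have [x [y [xA yA exy /andP[/andP[ux uy] /andP[vx vy]]]]] := avoid u v.
  have uH : u \in A :\ x :\ y by rewrite !inE uA ux uy.
  have [[cl _]|[ev reg]] := Q _ _ xA yA exy.
    by apply: cl; rewrite // !inE ?vA ?vx ?vy.
  have := even_regular_card ev reg (ltn_addl _ (isT : 0 < 3)) uH.
  by have := card_del_edge xA yA exy; rewrite cardA c0; clear; lia.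
have Qe x y : x \in A -> y \in A -> e x y ->
    even_triples (A :\ x :\ y) /\ regular (k + 3) (A :\ x :\ y).
  move=> xA yA exy; case: (Q _ _ xA yA exy) => // -[_ c].
  have /card_gt0P[v vH] : 0 < #|A :\ x0 :\ y0|.
    by have := card_del_edge xA yA exy; rewrite c cardA; clear; lia.
  have := even_regular_card ev0 reg0 (ltn_addl _ (isT : 0 < 3)) vH.
  by have := card_del_edge xA yA exy; rewrite cardA c; clear; lia.
have avoid3 a b c : a \in A -> b \in A -> e a b -> exists x y,
    [/\ x \in A, y \in A, e x y & forall d, d \in [:: a; b; c] -> (d != x) && (d != y)].
  move=> aA bA eab; have /has_matching1[x [y [xA yA exy]]] : has_matching 1 (A :\ a :\ b :\ c).
    apply: has_matchingD1.
    have QH := residues_are_edge two_regular_edge QA aA bA eab.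
    exact: has_matching_le (residues_are_matching two_regular_edge QH).
  move: xA yA; rewrite !inE => /and4P[xc xb xa xA] /and4P[yc yb ya yA].
  exists x, y; split=> // d; rewrite !inE ![d == x]eq_sym ![d == y]eq_sym.
  by case/or3P=> /eqP->; apply/andP.
have evA : even_triples A.
  apply: even_triples_of_edges => a b c aA bA cA ca cb eab.
  have [x [y [xA yA exy H]]] := avoid3 a b c aA bA eab.
  have mem d : d \in A -> d \in [:: a; b; c] -> d \in A :\ x :\ y.
    by move=> dA /H; rewrite !inE dA andbT andbC.
  have [ev _] := Qe _ _ xA yA exy.
  by rewrite -ev ?mem // !inE eqxx ?orbT.
right; split=> // z zA; have [x [y [xA yA exy /andP[/andP[zx zy] _]]]] := avoid z z.
have [_ reg] := Qe _ _ xA yA exy.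
rewrite (deg_edge _ xA yA exy) reg ?inE ?zx ?zy //.
by have := evA x y z xA yA zA; rewrite exy; case: (e z x); case: (e z y) => // _; clear; lia.
Qed.
(** * Graphs whose residues have one edge in every pairing *)

(** Equivalently, the triples a, b, c and b, c, d span the same number of edges
    modulo 2. *)
Definition quad A := forall a b c d, {subset [:: a; b; c; d] <= A} ->
  uniq [:: a; b; c; d] -> e a b (+) e c d = e a c (+) e b d.
Definition odd_triples A := {in A & &, forall x y z, uniq [:: x; y; z] ->
  e x y = ~~ (e z x (+) e z y)}.
(** The sets spanning a star K_(1,3) or a triangle with an isolated vertex. *)
Definition single_edge_pairings A := #|A| = 4 /\
  forall a b c d, {subset [:: a; b; c; d] <= A} -> uniq [:: a; b; c; d] ->
  e a b (+) e c d.

Lemma subset4 A a b c d : a \in A -> b \in A -> c \in A -> d \in A ->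
  {subset [:: a; b; c; d] <= A}.
Proof. by move=> aA bA cA dA x; rewrite !inE => /or4P[]/eqP->. Qed.

Lemma mem_subset4 A a b c d : {subset [:: a; b; c; d] <= A} ->
  [/\ a \in A, b \in A, c \in A & d \in A].
Proof. by move=> s; split; apply: s; rewrite !inE eqxx ?orbT. Qed.

Lemma uniq4 (a b c d : T) : uniq [:: a; b; c; d] =
  [&& a != b, a != c, a != d, b != c, b != d & c != d].
Proof. by rewrite /= !inE !negb_or !andbT -!andbA. Qed.

Lemma uniq3 (a b c : T) : uniq [:: a; b; c] = [&& a != b, a != c & b != c].
Proof. by rewrite /= !inE !negb_or !andbT -!andbA. Qed.

Ltac distinct := rewrite ?uniq4 ?uniq3; repeat (apply/andP; split);
  first [exact isT | assumption | rewrite eq_sym; assumption].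

Lemma four_points A : 4 <= #|A| -> exists a b c d,
  {subset [:: a; b; c; d] <= A} /\ uniq [:: a; b; c; d].
Proof.
move=> A4; have [x xA] : exists x, x \in A 
  by apply/card_gt0P; apply: leq_trans A4.
exists (nth x (enum A) 0), (nth x (enum A) 1), (nth x (enum A) 2), (nth x (enum A) 3).
have sz : 4 <= size (enum A) by rewrite -cardE.
split; last first.
  have := enum_uniq A; move: sz; case: (enum A) => [|a [|b [|c [|d s]]]] //= _.
  by rewrite !inE !negb_or -!andbA => /and5P[-> -> -> _ /and5P[-> -> _ -> _]].
by apply: subset4; rewrite -mem_enum mem_nth // (leq_trans _ sz).
Qed.

Lemma single_edge_pairings_edge A : single_edge_pairings A -> has_matching 1 A.
Proof.
move=> [A4 P]; have [|a [b [c [d [sA uA]]]]] := @four_points A; first by rewrite A4.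
have [aA bA cA dA] := mem_subset4 sA; apply/has_matching1.
by have := P a b c d sA uA; case E: (e a b); [exists a, b|exists c, d].
Qed.

(** If no edge of A avoids the four vertices a, b, c, d of an exchange identity,
    the remaining set R is independent and the identity is reached indirectly. *)
Section QuadExtend.
Variables (A R : {set T}).
Hypotheses (match3 : has_matching 3 A) (sRA : {subset R <= A}) (R4 : 4 <= #|R|).
Hypothesis del : forall x y, x \in A -> y \in A -> e x y ->
  has_matching 2 (A :\ x :\ y) /\ quad (A :\ x :\ y).
Hypothesis Rindep : {in R &, forall x y, ~~ e x y}.

(** Passing from a to d through a vertex r of R: the identities for {a, b, c, r}
    and {r, b, c, d} add up to the one for {a, b, c, d}, and they hold because
    the edges d r2 and a r1 avoid them. *)
Lemma quad_of_active a b c d r1 r2 : {subset [:: a; b; c; d] <= A} ->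
  uniq [:: a; b; c; d] -> {in R, forall r, r \notin [:: a; b; c; d]} ->
  r1 \in R -> e a r1 -> r2 \in R -> e d r2 ->
  e a b (+) e c d = e a c (+) e b d.
Proof.
move=> /mem_subset4[aA bA cA dA].
rewrite uniq4 => /and4P[ab ac ad /and3P[bc bd cd]] Rout r1R ear1 r2R edr2.
have [r] : exists r, r \in R :\ r1 :\ r2.
  apply/card_gt0P; move: R4 (cardsD1 r1 R) (cardsD1 r2 (R :\ r1)).
  by clear; do 2!case: (_ \in _); lia.
rewrite !inE => /and3P[rr2 rr1 rR].
have out q : q \in R -> [/\ q != a, q != b, q != c & q != d].
  by move/Rout; rewrite !inE !negb_or => /and4P[].
have [ra rb rc rd] := out _ rR; have [r1a r1b r1c r1d] := out _ r1R.
have [r2a r2b r2c r2d] := out _ r2R.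
have [_ Q1] := del dA (sRA r2R) edr2; have [_ Q2] := del aA (sRA r1R) ear1.
have E1 : e a b (+) e c r = e a c (+) e b r.
  by apply: Q1; [apply: subset4; rewrite !inE ?aA ?bA ?cA ?sRA //; distinct|distinct].
have E2 : e d b (+) e c r = e d c (+) e b r.
  by apply: Q2; [apply: subset4; rewrite !inE ?dA ?bA ?cA ?sRA //; distinct|distinct].
move: E1 E2; rewrite ![e d _]e_sym.
by case: (e a b); case: (e c r); case: (e a c); case: (e b r); case: (e b d); case: (e c d).
Qed.

(** If neither a nor b had a neighbour in R, then a b would be an edge and d would be
    adjacent to some r in R, for want of other disjoint edges. Deleting d r leaves a b
    and two vertices r1, r2 of R, with one edge in the pairing a b|r1 r2 and none in
    a r1|b r2. *)
Lemma no_inactive_pair a b c d : {subset [:: a; b; c; d] <= A} ->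
  uniq [:: a; b; c; d] -> {in R, forall r, r \notin [:: a; b; c; d]} ->
  {in A, forall v, (v \in [:: a; b; c; d]) || (v \in R)} ->
  {in R, forall r, ~~ e a r} -> {in R, forall r, ~~ e b r} -> False.
Proof.
move=> /mem_subset4[aA bA cA dA].
rewrite uniq4 => /and4P[ab ac ad /and3P[bc bd cd]] Rout AR na nb.
have eab : e a b.
  have /has_matching1[x [y [xA yA exy]]] : has_matching 1 (A :\ c :\ d).
    by do 2!apply: has_matchingD1.
  move: xA yA; rewrite !inE => /and3P[xd xc /AR xR] /and3P[yd yc /AR yR].
  have abR v w : (v == a) || (v == b) -> w \in R -> ~~ e v w.
    by case/orP=> /eqP->; [apply: na|apply: nb].
  move: xR yR; rewrite !inE (negbTE xd) (negbTE xc) (negbTE yd) (negbTE yc) !orbF.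
  case/orP=> [xab|xR] /orP[yab|yR].
  - move: exy; case/orP: xab => /eqP->; case/orP: yab => /eqP->; rewrite ?e_irr //.
    by rewrite e_sym.
  - by have := abR x y xab yR; rewrite exy.
  - by have := abR y x yab xR; rewrite e_sym exy.
  - by have := Rindep xR yR; rewrite exy.
have [r rR edr] : exists2 r, r \in R & e d r.
  have [M _] := del aA bA eab.
  have /has_matching1[x [y [xA yA exy]]] := has_matchingD1 c M.
  move: xA yA; rewrite !inE => /and4P[xc xb xa /AR xR] /and4P[yc yb ya /AR yR].
  move: xR yR exy; rewrite !inE (negbTE xa) (negbTE xb) (negbTE xc).
  rewrite (negbTE ya) (negbTE yb) (negbTE yc) /=.
  case/orP=> [/eqP->|xR] /orP[/eqP->|yR]; rewrite ?e_irr //; first by exists y.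
    by rewrite e_sym; exists x.
  by rewrite (negbTE (Rindep xR yR)).
have /card_gt1P[r1 [r2 [+ + r12]]] : 1 < #|R :\ r|.
  by move: R4 (cardsD1 r R); clear; case: (_ \in _); lia.
rewrite !inE => /andP[r1r r1R] /andP[r2r r2R].
have out q : q \in R -> [/\ q != a, q != b, q != c & q != d].
  by move/Rout; rewrite !inE !negb_or => /and4P[].
have [ra rb rc rd] := out _ rR; have [r1a r1b r1c r1d] := out _ r1R.
have [r2a r2b r2c r2d] := out _ r2R.
have [_ Q] := del dA (sRA rR) edr.
have : e a b (+) e r1 r2 = e a r1 (+) e b r2.
  by apply: Q; [apply: subset4; rewrite !inE ?aA ?bA ?sRA //; distinct|distinct].
by rewrite eab (negbTE (na _ r1R)) (negbTE (nb _ r2R)) (negbTE (Rindep r1R r2R)).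
Qed.

End QuadExtend.

(** Among the four vertices, call active those with a neighbour in R. Two
    inactive vertices cannot occur, so a, d or b, c are both active, and the identity
    is symmetric under exchanging these two pairs. *)
Lemma quad_extend A : 8 <= #|A| -> has_matching 3 A ->
  (forall x y, x \in A -> y \in A -> e x y ->
     has_matching 2 (A :\ x :\ y) /\ quad (A :\ x :\ y)) -> quad A.
Proof.
move=> A8 match3 del a b c d sA uA.
pose R := [set v in A | v \notin [:: a; b; c; d]].
have sRA : {subset R <= A} by move=> v /setIdP[].
have R4 : 4 <= #|R|.
  have sub : A \subset R :|: [set v in [:: a; b; c; d]].
    by apply/subsetP=> v vA; rewrite !inE vA /=; do 4!case: (v == _).
  have := leq_trans A8 (leq_trans (subset_leq_card sub) (leq_card_setU _ _)).
  have -> : #|[set v in [:: a; b; c; d]]| = 4 by rewrite cardsE (card_uniqP uA).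
  by rewrite (leq_add2r 4 4).
have Rout : {in R, forall r, r \notin [:: a; b; c; d]} by move=> r /setIdP[].
have AR : {in A, forall v, (v \in [:: a; b; c; d]) || (v \in R)}.
  by move=> v vA; rewrite [_ \in R]inE vA /= orbN.
have [/exists_inP[x xR /exists_inP[y yR exy]]|] :=
  boolP [exists x in R, exists y in R, e x y].
  have [_ Q] := del _ _ (sRA _ xR) (sRA _ yR) exy.
  apply: Q => // v vs; rewrite !inE (sA v vs) andbT.
  by apply/andP; split; apply: contraTneq vs => ->; exact: Rout.
rewrite negb_exists_in => /forall_inP Rind.
have Rindep : {in R &, forall x y, ~~ e x y}.
  by move=> x y xR yR; apply/negP=> exy; case/exists_inP: (Rind x xR); exists y.
pose active v := [exists r in R, e v r].
have act p q r t : perm_eq [:: p; q; r; t] [:: a; b; c; d] ->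
    active p -> active t -> e p q (+) e r t = e p r (+) e q t.
  move=> peq /exists_inP[r1 r1R e1] /exists_inP[r2 r2R e2].
  apply: (quad_of_active sRA R4 del _ _ _ r1R e1 r2R e2).
  - by move=> v; rewrite (perm_mem peq); apply: sA.
  - by rewrite (perm_uniq peq).
  - by move=> v /Rout; rewrite (perm_mem peq).
have some_active p q r t : perm_eq [:: p; q; r; t] [:: a; b; c; d] ->
    active p || active q.
  move=> peq; apply/negPn/negP; rewrite negb_or !negb_exists_in.
  case/andP=> /forall_inP np /forall_inP nq.
  apply: (@no_inactive_pair A R match3 sRA R4 del Rindep p q r t _ _ _ _ np nq).
  - by move=> v; rewrite (perm_mem peq); apply: sA.
  - by rewrite (perm_uniq peq).
  - by move=> v /Rout; rewrite (perm_mem peq).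
  - by move=> v /AR; rewrite (perm_mem peq).
have [actad|nad] := boolP (active a && active d).
  by case/andP: actad; apply: act.
have [/andP[actb actc]|nbc] := boolP (active b && active c).
  have := act b a d c; rewrite actb actc ![e b _]e_sym (e_sym d).
  move=> /(_ _ isT isT) ->; last by apply/permP=> p /=; clear; lia.
  by rewrite addbC [e d b]e_sym.
have Hab := some_active a b c d (perm_refl _).
have Hac : active a || active c.
  by apply: (some_active a c b d); apply/permP=> p /=; clear; lia.
have Hdb : active d || active b.
  by apply: (some_active d b a c); apply/permP=> p /=; clear; lia.
have Hdc : active d || active c.
  by apply: (some_active d c a b); apply/permP=> p /=; clear; lia.
move: nad nbc Hab Hac Hdb Hdc.
by case: (active a); case: (active b); case: (active c); case: (active d).
Qed.

(** In a set with the exchange identity, the parity of the number of edges in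
    a triple does not change when one vertex is replaced. *)
Lemma quad_even_or_odd A : quad A -> even_triples A \/ odd_triples A.
Proof.
move=> Q; pose t x y z := e x y (+) e y z (+) e x z.
have tE x y z : t x y z = e x y (+) e y z (+) e x z by [].
have tC x y z : t x y z = t y x z.
  by rewrite !tE (e_sym x y); case: (e y x); case: (e y z); case: (e x z).
have tR x y z : t x y z = t y z x.
  by rewrite !tE (e_sym x z) (e_sym x y); case: (e y x); case: (e y z); case: (e z x).
clearbody t; have tS x y z : t x y z = t x z y by rewrite tC tR.
have swap x y z w : {subset [:: x; y; z; w] <= A} -> uniq [:: x; y; z] ->
    w != y -> w != z -> t x y z = t w y z.
  move=> s; rewrite /= !inE negb_or andbT => /andP[/andP[xy xz] yz] wy wz.
  have [<-//|xw] := eqVneq x w.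
  have := Q x y z w s; rewrite !tE (e_sym z w) (e_sym y w).
  have -> : uniq [:: x; y; z; w] by distinct.
  by move=> /(_ isT); case: (e x y); case: (e y z); case: (e x z); case: (e w z); case: (e w y).
(* Any vertex can be made the first one of the triple. *)
have bring x y z w : {subset [:: x; y; z] <= A} -> uniq [:: x; y; z] -> w \in A ->
    exists y' z', [/\ {subset [:: w; y'; z'] <= A}, uniq [:: w; y'; z'] & t w y' z' = t x y z].
  move=> s u wA; have [->|wx] := eqVneq w x; first by exists y, z.
  have perm3 (f : pred T) : f y + (f z + (f x + 0)) = f x + (f y + (f z + 0)) by clear; lia.
  have perm3' (f : pred T) : f z + (f x + (f y + 0)) = f x + (f y + (f z + 0)) by clear; lia.
  have P : perm_eq [:: y; z; x] [:: x; y; z] by apply/permP; exact: perm3.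
  have P' : perm_eq [:: z; x; y] [:: x; y; z] by apply/permP; exact: perm3'.
  have [->|wy] := eqVneq w y.
    exists z, x; rewrite -(tR x) (perm_uniq P); split=> // v; rewrite (perm_mem P); exact: s.
  have [->|wz] := eqVneq w z.
    exists x, y; rewrite (tR z) (perm_uniq P'); split=> // v; rewrite (perm_mem P'); exact: s.
  exists y, z; split.
  - move=> v; rewrite inE => /predU1P[->//|vs]; apply: s; rewrite inE vs; exact: orbT.
  - by move: u; rewrite /= !inE !negb_or wy wz => /andP[].
  - rewrite -(swap x y z w) //; apply: subset4; rewrite // s // !inE eqxx ?orbT //.
have same x y z x' y' z' : {subset [:: x; y; z] <= A} -> uniq [:: x; y; z] ->
    {subset [:: x'; y'; z'] <= A} -> uniq [:: x'; y'; z'] -> t x y z = t x' y' z'.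
  move=> s u s' u'; have [|y1 [z1 [s1 u1 <-]]] := bring x y z x' s u.
    by apply: s'; rewrite !inE eqxx.
  have [x'A y'A z'A] : [/\ x' \in A, y' \in A & z' \in A].
    by split; apply: s'; rewrite !inE eqxx ?orbT.
  have [y1A z1A] : y1 \in A /\ z1 \in A by split; apply: s1; rewrite !inE eqxx ?orbT.
  move: u' u1; rewrite /= !inE !negb_or !andbT => /andP[/andP[xy' xz'] yz'].
  case/andP=> /andP[xy1 xz1] yz1.
  have [z2 [z2A x2 y2 <-]] : exists z2, [/\ z2 \in A, x' != z2, y' != z2
      & t x' y' z2 = t x' y1 z1].
    have [->|n1] := eqVneq y' y1; first by exists z1.
    have [->|n2] := eqVneq y' z1; first by exists y1; rewrite tS; split=> //; rewrite eq_sym.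
    exists z1; split=> //; rewrite (tC x' y') (tC x' y1).
    by apply: swap; [exact: subset4|distinct|rewrite eq_sym|].
  have [->//|n] := eqVneq z2 z'.
  rewrite -(tR z2) -(tR z'); apply: swap; [exact: subset4|distinct|by rewrite eq_sym|].
  by rewrite eq_sym.
have [|none] := boolP [exists x in A, exists y in A, exists z in A,
    uniq [:: x; y; z] && ~~ t x y z].
  move=> /exists_inP[x xA /exists_inP[y yA /exists_inP[z zA /andP[u /negbTE tF]]]].
  left; apply: even_triples_of_edges => a b c aA bA cA ca cb eab.
  have := same x y z a b c; rewrite tF tE eab (e_sym b c) (e_sym a c) => E.
  have : false = true (+) e c b (+) e c a.
    apply: E => //; try by move=> v; rewrite !inE => /or3P[]/eqP->.
    by rewrite /= !inE negb_or (edge_neq eab) ![_ == c]eq_sym ca cb.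
  by case: (e c a); case: (e c b).
right=> x y z xA yA zA u; move: none; rewrite negb_exists_in => /forall_inP/(_ x xA).
rewrite negb_exists_in => /forall_inP/(_ y yA); rewrite negb_exists_in => /forall_inP/(_ z zA).
rewrite u negbK tE (e_sym y z) (e_sym x z).
by case: (e x y); case: (e z x); case: (e z y).
Qed.

(** On six vertices, every pairing contains an even number of edges: once it
    contains one edge, exactly one of the other two pairs is an edge. *)
Lemma residue1_single_edge_quad A :
  residues_are 1 A single_edge_pairings -> quad A.
Proof.
move=> QA a b c d s u.
have cardA : #|A| = 6.
  by have [[B r] /(_ _ r)[B4 _]] := QA; rewrite (residue_card r) B4.
have c4 : #|[set v in [:: a; b; c; d]]| = 4 by rewrite cardsE (card_uniqP u).
have Rs : #|A :\: [set v in [:: a; b; c; d]]| = 2.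
  rewrite cardsD (setIidPr _) ?c4 ?cardA //.
  by apply/subsetP=> v; rewrite inE; apply: s.
have /card_gt1P[f [g [+ + fg]]] : 1 < #|A :\: [set v in [:: a; b; c; d]]| by rewrite Rs.
rewrite in_setD inE => /andP[fN fA]; rewrite in_setD inE => /andP[gN gA].
have u6 : uniq [:: f, g & [:: a; b; c; d]].
  by rewrite (cons_uniq f) (cons_uniq g) u gN inE negb_or fg fN.
have s6 : {subset [:: f, g & [:: a; b; c; d]] <= A}.
  by move=> v; rewrite inE => /predU1P[->//|]; rewrite inE => /predU1P[->//|/s].
have P v w p q r t : perm_eq [:: v; w; p; q; r; t] [:: f, g & [:: a; b; c; d]] ->
    e v w -> e p q (+) e r t.
  move=> peq evw; have sub z : z \in [:: v; w; p; q; r; t] -> z \in A.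
    by rewrite (perm_mem peq); apply: s6.
  have /andP[vN /andP[wN u4]] : uniq (v :: w :: [:: p; q; r; t]) by rewrite (perm_uniq peq).
  have vA : v \in A by apply: sub; rewrite inE eqxx.
  have wA : w \in A by apply: sub; rewrite !inE eqxx orbT.
  have [_ /(_ _ erefl)[_]] := residues_are_edge single_edge_pairings_edge QA vA wA evw.
  apply=> // z zs; have zvw : z \in [:: w, p, q, r & [:: t]] by rewrite inE zs orbT.
  rewrite !in_setD1 sub ?andbT; last by rewrite inE zvw orbT.
  by apply/andP; split; [apply: contraNneq wN => <-|apply: contraNneq vN => <-].
have E p q r t v w : perm_eq [:: p; q; r; t; v; w] [:: f, g & [:: a; b; c; d]] ->
    e p q (+) e r t = e v w.
  move=> peq; have count (h : pred T) : h f + (h g + (h a + (h b + (h c + (h d + 0))))) =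
    h p + (h q + (h r + (h t + (h v + (h w + 0))))) by have /permP/(_ h) := peq.
  have [evw|/negbTE nvw] := boolP (e v w).
    by apply: P evw; apply/permP=> h /=; rewrite count; clear; lia.
  have [epq|npq] := boolP (e p q).
    by have := P p q r t v w peq epq; rewrite nvw addbF => ->.
  have [ert|nrt] := boolP (e r t); last by [].
  have : e p q (+) e v w by apply: P ert; apply/permP=> h /=; rewrite count; clear; lia.
  by rewrite nvw (negbTE npq).
by rewrite (E a b c d f g) ?(E a c b d f g) //; apply/permP=> h /=; clear; lia.
Qed.

(** With eight or more vertices, an edge is deleted and the induction hypothesis
    is carried over by quad_extend. *)
Theorem residues_single_edge_quad k A :
  residues_are k A single_edge_pairings -> quad A.
Proof.
elim: k A => [|[|k] IH] A QA.
- have [_ /(_ A erefl)[_ P]] := QA; move=> a b c d s u.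
  have [aA bA cA dA] := mem_subset4 s.
  rewrite (P a b c d s u) (P a c b d) //; first exact: subset4.
  by move: u; rewrite !uniq4 => /and4P[? ? ? /and3P[? ? ?]]; distinct.
- exact: residue1_single_edge_quad.
apply: quad_extend.
- have [[B r] /(_ _ r)[B4 _]] := QA; rewrite (residue_card r) B4.
  by clear; lia.
- exact: has_matching_le (residues_are_matching single_edge_pairings_edge QA).
move=> x y xA yA exy.
have QH := residues_are_edge single_edge_pairings_edge QA xA yA exy.
split; last exact: IH QH.
exact: has_matching_le (residues_are_matching single_edge_pairings_edge QH).
Qed.
(** * Sets whose subsets of a given size all have two outgoing edges *)

Lemma subset_of_card A k : k <= #|A| -> exists2 B : {set T}, B \subset A & #|B| = k.
Proof.
elim: k => [|k IH] kA; first by exists set0; rewrite ?sub0set ?cards0.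
have [B sBA Bk] := IH (ltnW kA).
have /card_gt0P[x] : 0 < #|A :\: B|.
  by rewrite cardsD (setIidPr sBA) Bk subn_gt0.
rewrite inE => /andP[xB xA]; exists (x |: B); last by rewrite cardsU1 xB Bk.
by rewrite subUset sub1set xA.
Qed.

Definition balanced s A := forall S, S \subset A -> #|S| = s -> cut S (A :\: S) = 2.

Lemma cut_const S U b : (forall x y, x \in S -> y \in U -> e x y = b) ->
  cut S U = b * (#|S| * #|U|).
Proof.
move=> E; transitivity (\sum_(x in S) \sum_(y in U) (b : nat)).
  by apply: eq_bigr => x xS; apply: eq_bigr => y yU; rewrite E.
by rewrite sum_nat_const sum_nat_const mulnA mulnC.
Qed.

Lemma cut1l U v : cut [set v] U = deg U v.
Proof. by rewrite /cut big_set1. Qed.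

Lemma balanced1 A : balanced 1 A <-> regular 2 A.
Proof.
have E v : v \in A -> cut [set v] (A :\: [set v]) = deg A v.
  by move=> vA; rewrite cut1l (degD1 _ vA) e_irr.
split=> [bal v vA|reg S sSA /eqP/cards1P[v Sv]].
  by rewrite -E // bal ?sub1set ?cards1.
by move: sSA; rewrite Sv sub1set => vA; rewrite E // reg.
Qed.

Lemma balanced_compl A s u : #|A| = s + u -> balanced s A -> balanced u A.
Proof.
move=> cA bal S sSA Su; have SE : A :\: (A :\: S) = S.
  by rewrite setDDr setDv set0U (setIidPr sSA).
rewrite cutC -{2}SE; apply: bal; first exact: subsetDl.
by rewrite cardsD (setIidPr sSA) cA Su addnK.
Qed.

Lemma degU1 U x v : x \notin U -> deg (x |: U) v = e v x + deg U v.
Proof. by move=> xU; rewrite /deg big_setU1. Qed.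

Lemma cutU1l S U x : x \notin S -> cut (x |: S) U = deg U x + cut S U.
Proof. by move=> xS; rewrite /cut big_setU1. Qed.

Lemma cutU1r S U x : x \notin U -> cut S (x |: U) = deg S x + cut S U.
Proof. by move=> xU; rewrite cutC cutU1l // cutC. Qed.

(** Fix a set B of s - 2 further vertices. In the sum of the cuts of B + a + c and
    B + b + d, and in that for B + a + d and B + b + c, the links to the other
    vertices contribute equally, so the links among a, b, c, d balance as well. *)
Lemma balanced_exchange A s u a b c d : #|A| = s + u -> 2 <= s -> 2 <= u ->
  balanced s A -> {subset [:: a; b; c; d] <= A} -> uniq [:: a; b; c; d] ->
  e a c + e b d = e a d + e b c.
Proof.
move=> cA s2 u2 bal sA uA; have [aA bA cA' dA] := mem_subset4 sA.
pose R := A :\: [set v in [:: a; b; c; d]].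
have cR : #|R| = s + u - 4.
  rewrite cardsD (setIidPr _) ?cardsE ?(card_uniqP uA) ?cA //.
  by apply/subsetP=> v; rewrite inE; apply: sA.
have [B sBR cB] : exists2 B : {set T}, B \subset R & #|B| = s - 2.
  by apply: subset_of_card; rewrite cR; move: s2 u2; clear; lia.
pose W := R :\: B.
have inR x : (x \in R) = (x \notin [:: a; b; c; d]) && (x \in A).
  by rewrite in_setD [_ \in [set _ in _]]inE.
have inW x : (x \in W) = (x \notin B) && (x \in R) by rewrite in_setD.
clearbody W R; have outR x : x \in [:: a; b; c; d] -> x \notin R by rewrite inR => ->.
have outB x : x \in [:: a; b; c; d] -> x \notin B.
  by move/outR; apply: contra; apply: (subsetP sBR).
have outW x : x \in [:: a; b; c; d] -> x \notin W.
  by move/outR; apply: contra; rewrite inW => /andP[].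
have E p q r t : perm_eq [:: p; q; r; t] [:: a; b; c; d] ->
    (deg W p + deg W q + deg B r + deg B t + cut B W) +
    (e p r + e p t + e q r + e q t) = 2.
  move=> peq; have uq : uniq [:: p; q; r; t].
    by rewrite (perm_uniq peq).
  move: (uq); rewrite uniq4 => /and4P[pq pr pt /and3P[qr qt rt]].
  have out x : x \in [:: p; q; r; t] -> [/\ x \in A, x \notin R, x \notin B & x \notin W].
    by rewrite (perm_mem peq) => xs; split; auto.
  have mem x : (x \in A) = (x \in [:: p; q; r; t]) || (x \in R).
    rewrite (perm_mem peq) inR.
    by case xs : (x \in [:: a; b; c; d]) => //=; rewrite (sA _ xs).
  have [pA pR pB pW] : [/\ p \in A, p \notin R, p \notin B & p \notin W].
    by apply: out; rewrite !inE eqxx ?orbT.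
  have [qA qR qB qW] : [/\ q \in A, q \notin R, q \notin B & q \notin W].
    by apply: out; rewrite !inE eqxx ?orbT.
  have [rA rR rB rW] : [/\ r \in A, r \notin R, r \notin B & r \notin W].
    by apply: out; rewrite !inE eqxx ?orbT.
  have [tA tR tB tW] : [/\ t \in A, t \notin R, t \notin B & t \notin W].
    by apply: out; rewrite !inE eqxx ?orbT.
  have cS : #|p |: (q |: B)| = s.
    by rewrite !cardsU1 !inE negb_or pq pB qB cB; move: s2; clear; lia.
  have sS : p |: (q |: B) \subset A.
    by rewrite !subUset !sub1set pA qA; apply/subsetP=> x /(subsetP sBR); rewrite mem orbC => ->.
  have dE : A :\: (p |: (q |: B)) = r |: (t |: W).
    apply/setP=> x; rewrite in_setD !inE mem !inE inW.
    have [->|xp] := eqVneq x p; first by rewrite (negbTE pr) (negbTE pt) (negbTE pR) andbF.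
    have [->|xq] := eqVneq x q; first by rewrite (negbTE qr) (negbTE qt) (negbTE qR) andbF.
    have [->|xr] := eqVneq x r; first by rewrite rB.
    by have [->|xt] := eqVneq x t; first by rewrite tB.
  have := bal _ sS cS; rewrite dE.
  rewrite cutU1l ?inE ?negb_or ?pq // cutU1l // !degU1 ?inE ?negb_or ?rt //.
  rewrite (cutU1r _ (x := r)) ?inE ?negb_or ?rt // cutU1r //.
  by clear; lia.
have P1 : perm_eq [:: a; b; c; d] [:: a; b; c; d] by [].
have P2 : perm_eq [:: c; d; a; b] [:: a; b; c; d] by apply/permP=> f /=; clear; lia.
have P3 : perm_eq [:: a; c; b; d] [:: a; b; c; d] by apply/permP=> f /=; clear; lia.
have P4 : perm_eq [:: b; d; a; c] [:: a; b; c; d] by apply/permP=> f /=; clear; lia.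
have P5 : perm_eq [:: a; d; b; c] [:: a; b; c; d] by apply/permP=> f /=; clear; lia.
have P6 : perm_eq [:: b; c; a; d] [:: a; b; c; d] by apply/permP=> f /=; clear; lia.
move: (E _ _ _ _ P3) (E _ _ _ _ P4) (E _ _ _ _ P5) (E _ _ _ _ P6).
rewrite (e_sym b a) (e_sym d a) (e_sym d c) (e_sym c a) (e_sym c b) (e_sym d b).
by clear; lia.
Qed.
(** The rule propagates the adjacencies of z, which has two neighbours y, x and a
    non-neighbour w, to all other vertices. The lemma is stated for an arbitrary
    relation f so that it applies both to adjacency and to non-adjacency. *)
Lemma isolated_of_exchange (f : rel T) A z y x w : symmetric f ->
  (forall p q r t, {subset [:: p; q; r; t] <= A} -> uniq [:: p; q; r; t] ->
     f p q -> ~~ f p r -> f t q && ~~ f t r) ->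
  {subset [:: z; y; x; w] <= A} -> uniq [:: z; y; x; w] ->
  f z y -> f z x -> ~~ f z w ->
  {in A, forall v, v != w -> ~~ f w v} /\
  {in A &, forall u v, u != w -> v != w -> u != v -> f u v}.
Proof.
move=> f_sym rule /mem_subset4[zA yA xA wA].
rewrite uniq4 => /and4P[zy zx zw /and3P[yx yw xw]] fzy fzx nfzw.
have rule' p q r t : p \in A -> q \in A -> r \in A -> t \in A ->
    uniq [:: p; q; r; t] -> f p q -> ~~ f p r -> f t q /\ ~~ f t r.
  by move=> pA qA rA tA u fpq nfpr; apply/andP; apply: (rule p) => //; apply: subset4.
have wv v : v \in A -> v != w -> ~~ f w v.
  move=> vA vw; have [->|vz] := eqVneq v z; first by rewrite f_sym.
  have [->|vy] := eqVneq v y; rewrite f_sym.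
    by case: (rule' z x w y) => //; distinct.
  by case: (rule' z y w v) => //; distinct.
have zv v : v \in A -> v != w -> v != z -> f z v.
  move=> vA vw vz; apply/negPn/negP => nfzv.
  have vy : v != y by apply: contraNneq nfzv => ->.
  have vx : v != x by apply: contraNneq nfzv => ->.
  have [|fvy _] := rule' z y w v zA yA wA vA _ fzy nfzw; first by distinct.
  have [|_] := rule' z x v y zA xA vA yA _ fzx nfzv; first by distinct.
  by rewrite f_sym fvy.
split=> // u v uA vA uw vw uv.
have [uz|uz] := eqVneq u z; first by rewrite uz zv // -uz eq_sym.
have [vz|vz] := eqVneq v z; first by rewrite vz f_sym zv.
rewrite f_sym; case: (rule' z u w v) => //; last exact: zv.
by distinct.
Qed.

(** If some vertex z has both a neighbour and a non-neighbour, then one of these two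
    is a vertex c as in the third alternative: the centre of a star if b holds, and an
    isolated vertex beside a complete graph otherwise. *)
Lemma cone_of_exchange A : 4 <= #|A| ->
  (forall a b c d, {subset [:: a; b; c; d] <= A} -> uniq [:: a; b; c; d] ->
     e a c + e b d = e a d + e b c) ->
  [\/ {in A &, forall x y, ~~ e x y}, clique A | exists c b, [/\ c \in A,
    {in A, forall x, x != c -> e c x = b} &
    {in A &, forall x y, x != c -> y != c -> x != y -> e x y = ~~ b}]].
Proof.
move=> A4 exch.
have [|none] := boolP [exists z in A, exists y in A, exists w in A,
    [&& w != z, e z y & ~~ e z w]].
  move=> /exists_inP[z zA /exists_inP[y yA /exists_inP[w wA /and3P[wz ezy nezw]]]].
  apply: Or33; have yz := edge_neq ezy; have yw : y != w by apply: contraNneq nezw => <-.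
  have rule p q r t : {subset [:: p; q; r; t] <= A} -> uniq [:: p; q; r; t] ->
     e p q -> ~~ e p r -> e t q && ~~ e t r.
    move=> /mem_subset4[pA qA rA tA]; rewrite uniq4 => /and4P[pq pr pt /and3P[qr qt rt]] epq.
    move=> /negbTE npr; have := exch p t q r; rewrite epq npr.
    have -> : uniq [:: p; t; q; r] by distinct.
    by move=> /(_ (subset4 pA tA qA rA) isT); case: (e t q); case: (e t r).
  have [x] : exists x, x \in A :\ z :\ y :\ w.
    apply/card_gt0P; move: A4 (cardsD1 z A) (cardsD1 y (A :\ z)) (cardsD1 w (A :\ z :\ y)).
    by clear; do 3!case: (_ \in _); lia.
  rewrite !inE => /and4P[xw xy xz xA].
  have [ezx|nezx] := boolP (e z x).
    case: (@isolated_of_exchange e A z y x w e_sym rule) => //.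
    - exact: subset4.
    - by distinct.
    - by move=> iso full; exists w, false; split=> // v vA /(iso v vA) /negbTE.
  case: (@isolated_of_exchange (fun u v => ~~ e u v) A z w x y); rewrite ?negbK //.
  - by move=> u v; rewrite e_sym.
  - move=> p q r t s u; rewrite negbK => npq epr; rewrite andbC negbK.
    apply: (rule p r q t) => //.
      by move=> v vs; apply: s; move: vs; rewrite !inE; do 4!case: (v == _).
    by move: u; rewrite !uniq4 => /and4P[? ? ? /and3P[? ? ?]]; distinct.
  - exact: subset4.
  - by distinct.
  - move=> iso full; exists y, true; split=> // [v vA /(iso v vA)|u v uA vA uy vy uv].
      by move/negPn.
    by apply/negbTE; apply: full.
have {}none z y w : z \in A -> y \in A -> w \in A -> w != z -> e z y -> e z w.
  move=> zA yA wA wz ezy; apply: contraNT none => nezw.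
  by apply/exists_inP; exists z => //; apply/exists_inP; exists y => //;
     apply/exists_inP; exists w => //; apply/and3P.
have [/exists_inP[x0 x0A /exists_inP[y0 y0A e0]]|indep] :=
  boolP [exists x in A, exists y in A, e x y].
  apply: Or32 => x y xA yA xy.
  have [xx0|xx0] := eqVneq x x0.
    by apply: (none _ y0); rewrite // ?xx0 // -xx0 eq_sym.
  by apply: (none _ x0) => //; rewrite 1?eq_sym // e_sym; apply: (none _ y0).
apply: Or31 => x y xA yA; apply: contraNN indep => exy.
by apply/exists_inP; exists x => //; apply/exists_inP; exists y.
Qed.

Lemma subset_through A c s : 0 < s <= #|A| -> c \in A -> exists S : {set T},
  [/\ S \subset A, #|S| = s & c \in S].
Proof.
case/andP=> s0 sA cA; have [|B sB cB] := @subset_of_card (A :\ c) s.-1.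
  by move: sA; rewrite (cardsD1 c A) cA; case: (s) s0.
exists (c |: B); rewrite setU11; split=> //.
  by rewrite subUset sub1set cA (subset_trans sB (subD1set _ _)).
by rewrite cardsU1 cB; case: (c \in B) / boolP => [/(subsetP sB)|_];
  rewrite ?inE ?eqxx //; case: (s) s0.
Qed.

Lemma subset_avoiding A c s : s < #|A| -> c \in A -> exists S : {set T},
  [/\ S \subset A, #|S| = s & c \notin S].
Proof.
move=> sA cA; have [|B sB cB] := @subset_of_card (A :\ c) s.
  by move: sA; rewrite (cardsD1 c A) cA.
exists B; split=> //; first exact: subset_trans sB (subD1set _ _).
by apply/negP=> /(subsetP sB); rewrite !inE eqxx.
Qed.

(** A complete graph has too many edges across a cut. For a cone with apex c, a
    subset containing c and one avoiding c give two equations for s and u. *)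
Theorem balanced_single_edge A s u : #|A| = s + u -> 2 <= s -> 2 <= u ->
  balanced s A -> [/\ s = 2, u = 2 & single_edge_pairings A].
Proof.
move=> cA s2 u2 bal.
have A4 : 4 <= #|A| by rewrite cA (leq_add s2 u2).
have cD S : S \subset A -> #|S| = s -> #|A :\: S| = u.
  by move=> sS Ss; rewrite cardsD (setIidPr sS) cA Ss addKn.
have const b : {in A &, forall x y, x != y -> e x y = b} -> 2 = b * (s * u).
  move=> E; have [|S sS Ss] := @subset_of_card A s; first by rewrite cA leq_addr.
  rewrite -(bal S sS Ss) (@cut_const _ _ b) ?cD ?Ss //.
  move=> x y xS /setDP[yA yS]; apply: E => //; first exact: (subsetP sS).
  by apply: contraNneq yS => <-.
have [] := cone_of_exchange A4 (fun a b c d => @balanced_exchange A s u a b c d cA s2 u2 bal).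
- by move=> E; have := const false (fun x y xA yA _ => negbTE (E x y xA yA)).
- move=> E; have := const true E; rewrite mul1n => su.
  by have := leq_mul s2 u2; rewrite -su.
move=> [c [b [cinA cb E]]].
have [|S [sS Ss cS]] := @subset_through A c s _ cinA.
  by rewrite cA leq_addr (leq_trans _ s2).
have [|S' [sS' Ss' cS']] := @subset_avoiding A c s _ cinA.
  by rewrite cA -addn1 leq_add2l ltnW.
have H1 : b * u + ~~ b * (s.-1 * u) = 2.
  rewrite -(bal S sS Ss) (cutDl _ cS) -cut1l (@cut_const [set c] _ b); last first.
    move=> x y /set1P-> /setDP[yA yS]; apply: cb => //.
    by apply: contraNneq yS => ->.
  rewrite (@cut_const _ _ (~~ b)); last first.
    move=> x y; rewrite !inE => /andP[xc xS] /andP[yS yA]; apply: E => //.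
    - exact: (subsetP sS).
    - by apply: contraNneq yS => ->.
    - by apply: contraNneq yS => <-.
  by rewrite cD // cards1 mul1n; move: Ss; rewrite (cardsD1 c S) cS => <-.
have cDS' : c \in A :\: S' by rewrite inE cS'.
have H2 : b * s + ~~ b * (u.-1 * s) = 2.
  rewrite -(bal S' sS' Ss') cutC (cutDl _ cDS') -cut1l (@cut_const [set c] _ b); last first.
    move=> x y /set1P-> yS; apply: cb; first exact: (subsetP sS').
    by apply: contraNneq cS' => <-.
  rewrite (@cut_const _ _ (~~ b)); last first.
    move=> x y; rewrite !inE => /andP[xc /andP[xS xA]] yS; apply: E => //.
    - exact: (subsetP sS').
    - by apply: contraNneq cS' => <-.
    - by apply: contraNneq xS => ->.
  by rewrite cards1 mul1n Ss' -(cD S') // (cardsD1 c (A :\: S')) cDS'.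
have [s_2 u_2] : s = 2 /\ u = 2.
  move: H1 H2 s2 u2; clear; case: b => /=; first by lia.
  by rewrite !mul0n !mul1n !add0n; case: s => [|[|[|s]]]; case: u => [|[|[|u]]] //=; nia.
split=> //; split; first by rewrite cA s_2 u_2.
move=> p q r t sub uq; have [pA qA rA tA] := mem_subset4 sub.
have sE : [set v in [:: p; q; r; t]] = A.
  apply/eqP; rewrite eqEcard cA s_2 u_2 cardsE (card_uniqP uq) andbT.
  by apply/subsetP=> v; rewrite inE; apply: sub.
move: cinA; rewrite -{1}sE !inE; move: uq; rewrite uniq4.
case/and4P=> pq pr pt /and3P[qr qt rt] /or4P[]/eqP cE; move: cb E; rewrite cE => cb E.
- have -> : e p q = b by apply: cb => //; rewrite eq_sym.
  have -> : e r t = ~~ b by apply: E => //; rewrite eq_sym.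
  by case: (b).
- have -> : e p q = b by rewrite e_sym; apply: cb.
  have -> : e r t = ~~ b by apply: E => //; rewrite eq_sym.
  by case: (b).
- have -> : e r t = b by apply: cb => //; rewrite eq_sym.
  have -> : e p q = ~~ b by apply: E.
  by case: (b).
- have -> : e r t = b by rewrite e_sym; apply: cb.
  have -> : e p q = ~~ b by apply: E.
  by case: (b).
Qed.
(** * Degrees and colour classes *)

Lemma four_points_of A v : #|A| = 4 -> v \in A -> exists b c d,
  [/\ {subset [:: v; b; c; d] <= A}, uniq [:: v; b; c; d]
    & deg A v = e v b + e v c + e v d].
Proof.
move=> A4 vA; rewrite (degD1 _ vA) e_irr add0n /deg -big_enum /=.
have sz : size (enum (A :\ v)) = 3.
  by rewrite -cardE; move: A4; rewrite (cardsD1 v A) vA => -[].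
have sub w : w \in enum (A :\ v) -> (w != v) && (w \in A) by rewrite mem_enum !inE.
have := enum_uniq (A :\ v); case: (enum _) sz sub => [|b [|c [|d [|]]]] // _ sub uq.
have [/andP[bv bA] /andP[cv cA] /andP[dv dA]] :
    [/\ (b != v) && (b \in A), (c != v) && (c \in A) & (d != v) && (d \in A)].
  by split; apply: sub; rewrite !inE eqxx ?orbT.
have uq4 : uniq [:: v; b; c; d] by rewrite cons_uniq uq !inE !negb_or; distinct.
exists b, c, d; split=> //; first exact: subset4.
by rewrite !big_cons big_nil addn0 addnA.
Qed.

Lemma even_triples_sub A B : B \subset A -> even_triples A -> even_triples B.
Proof. by move=> /subsetP s ev x y z xB yB zB; apply: ev; apply: s. Qed.

Lemma odd_triples_sub A B : B \subset A -> odd_triples A -> odd_triples B.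
Proof. by move=> /subsetP s ev x y z xB yB zB; apply: ev; apply: s. Qed.

Lemma edge_avoiding A z : has_matching 2 A -> exists x y,
  [/\ x \in A, y \in A, e x y & z \in A -> z \in A :\ x :\ y].
Proof.
move/(has_matchingD1 z)/has_matching1=> [x [y []]]; rewrite !inE.
move=> /andP[xz xA] /andP[yz yA] exy; exists x, y; split=> // zA.
by rewrite !inE zA ![z == _]eq_sym xz yz.
Qed.

Lemma residues_single_edge_matching2 k A :
  residues_are k.+1 A single_edge_pairings -> has_matching 2 A.
Proof.
move/(residues_are_matching single_edge_pairings_edge).
by elim: k => // k IH /has_matchingW/IH.
Qed.

(** By parity of triples, a vertex off an edge is adjacent to exactly one end of the edge,
    so deleting the edge lowers its degree by one. *)
Lemma even_residues_deg k A : residues_are k A single_edge_pairings ->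
  even_triples A -> {in A, forall v, deg A v = k.+1 \/ deg A v = k.+3}.
Proof.
elim: k A => [|k IH] A QA ev v vA.
  have [_ /(_ A erefl)[A4 P]] := QA.
  have [b [c [d [s u ->]]]] := four_points_of A4 vA.
  have [_ bA cA dA] := mem_subset4 s.
  have := P v b c d s u; rewrite (ev c d v) //.
  by case: (e v b); case: (e v c); case: (e v d) => // _; [right|left|left|left].
have [x [y [xA yA exy /(_ vA) vH]]] := edge_avoiding v (residues_single_edge_matching2 QA).
have QH := residues_are_edge single_edge_pairings_edge QA xA yA exy.
have sub : A :\ x :\ y \subset A by apply: subset_trans (subD1set _ _) (subD1set _ _).
rewrite (deg_edge _ xA yA exy); have := IH _ QH (even_triples_sub sub ev) v vH.
have := ev x y v xA yA vA; rewrite exy.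
by case: (e v x); case: (e v y) => //= _ [] ->; [left|right|left|right].
Qed.

(** By parity of triples, a vertex off an edge is adjacent to both ends of the edge or to
    none. *)
Lemma odd_residues_deg k A : residues_are k A single_edge_pairings ->
  odd_triples A -> {in A, forall v, ~~ odd (deg A v)}.
Proof.
elim: k A => [|k IH] A QA od v vA.
  have [_ /(_ A erefl)[A4 P]] := QA.
  have [b [c [d [s u ->]]]] := four_points_of A4 vA.
  have [_ bA cA dA] := mem_subset4 s.
  have := P v b c d s u; rewrite (od c d v) //.
    by case: (e v b); case: (e v c); case: (e v d).
  by move: u; rewrite uniq4 => /and4P[? ? ? /and3P[? ? ?]]; distinct.
have [x [y [xA yA exy /(_ vA) vH]]] := edge_avoiding v (residues_single_edge_matching2 QA).
have QH := residues_are_edge single_edge_pairings_edge QA xA yA exy.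
have sub : A :\ x :\ y \subset A by apply: subset_trans (subD1set _ _) (subD1set _ _).
rewrite (deg_edge _ xA yA exy) oddD negb_add; have := IH _ QH (odd_triples_sub sub od) v vH.
move: vH; rewrite !inE => /and3P[vy vx _].
have := od x y v xA yA vA; rewrite exy uniq3 (edge_neq exy) ![_ == v]eq_sym vx vy => /(_ isT).
by case: (e v x); case: (e v y) => //= _ /negbTE->.
Qed.

(** The colour classes are the neighbourhoods of z and of w. *)
Lemma even_triples_colored z w : even_triples setT -> e z w ->
  exists B : {set T}, [/\ colored addb e B, #|B| = deg setT z & #|~: B| = deg setT w].
Proof.
move=> ev ezw; exists [set v | e z v]; split.
- move=> x y; rewrite !inE; have [->|_] := eqVneq x y; first by rewrite e_irr.
  by apply: ev; rewrite inE.
- by rewrite deg_card; apply: eq_card => v; rewrite !inE.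
- rewrite deg_card; apply: eq_card => v; rewrite !inE (ev w v z) ?inE // ezw.
  by case: (e z v).
Qed.

(** One colour class is the closed neighbourhood of z. *)
Lemma odd_triples_colored z : odd_triples setT ->
  exists B : {set T}, colored (fun a b => a == b) e B /\ #|B| = (deg setT z).+1.
Proof.
move=> od; exists (z |: [set v | e z v]); split; last first.
  rewrite cardsU1 inE e_irr deg_card add1n; congr _.+1.
  by apply: eq_card => v; rewrite !inE.
move=> x y; rewrite !inE; have [->|xy] := eqVneq x y; first by rewrite e_irr.
have [xz|xz] := eqVneq x z; first by rewrite -xz [y == x]eq_sym (negbTE xy); case: (e x y).
have [yz|yz] := eqVneq y z; first by rewrite -yz e_sym; case: (e y x).
rewrite (od x y z) ?inE //=; first by case: (e z x); case: (e z y).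
by rewrite !inE negb_or xy xz yz.
Qed.

Lemma colored_addbC B : colored addb e B -> colored addb e (~: B).
Proof. by move=> cB x y; rewrite cB !inE; case: (x \in B); case: (y \in B). Qed.

Lemma card_colorD1 A B x : x \in A ->
  #|A :&: B| = (x \in B) + #|(A :\ x) :&: B|.
Proof. by move=> xA; rewrite (cardsD1 x) !inE xA -setIDAC. Qed.

Lemma card_color_edge A B x y : x \in A -> y \in A -> e x y ->
  #|A :&: B| = (x \in B) + (y \in B) + #|(A :\ x :\ y) :&: B|.
Proof.
move=> xA yA exy; rewrite (card_colorD1 _ xA) (@card_colorD1 _ _ y) ?addnA //.
by rewrite !inE yA eq_sym (edge_neq exy).
Qed.

(** Each edge has one end in either colour class. *)
Lemma residue_addb k A A' B : colored addb e B -> residue k A A' ->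
  #|A :&: B| = #|A' :&: B| + k /\ #|A :\: B| = #|A' :\: B| + k.
Proof.
move=> cB; elim: k A => [|k IH] A /=; first by move->; rewrite !addn0.
move=> [x [y [xA yA exy /IH[E1 E2]]]]; rewrite (setDE A B).
rewrite (card_color_edge B xA yA exy) (card_color_edge (~: B) xA yA exy).
rewrite -(setDE (A :\ x :\ y)) E1 E2 !inE.
move: exy; rewrite cB => /andP[_].
by case: (x \in B); case: (y \in B) => // _; rewrite !addn0 ?add0n !add1n !addnS.
Qed.

(** Each edge lies within one colour class. *)
Lemma residue_eqb k A A' B : colored (fun a b => a == b) e B -> residue k A A' ->
  odd #|A :&: B| = odd #|A' :&: B| /\ odd #|A :\: B| = odd #|A' :\: B|.
Proof.
move=> cB; elim: k A => [|k IH] A /=; first by move->.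
move=> [x [y [xA yA exy /IH[E1 E2]]]]; rewrite (setDE A B).
rewrite (card_color_edge B xA yA exy) (card_color_edge (~: B) xA yA exy).
rewrite -(setDE (A :\ x :\ y)) !oddD E1 E2 !inE.
move: exy; rewrite cB => /andP[_ /eqP->].
by rewrite addbb; split; case: (y \in B).
Qed.

Lemma sum_by_color S B (F : bool -> nat) :
  \sum_(x in S) F (x \in B) = #|S :&: B| * F true + #|S :\: B| * F false.
Proof.
rewrite (big_setID B) /= -!sum_nat_const; congr (_ + _); apply: eq_bigr => x.
  by rewrite inE => /andP[_ ->].
by rewrite inE => /andP[/negbTE-> _].
Qed.

Lemma cut_colored r B S A : colored r e B -> S \subset A ->
  let s := #|S :&: B| in let t := #|S :\: B| in
  let s' := #|A :&: B| - s in let t' := #|A :\: B| - t in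
  [/\ s <= #|A :&: B|, t <= #|A :\: B|, s + t = #|S| &
  cut S (A :\: S) = s * (s' * r true true + t' * r true false)
                  + t * (s' * r false true + t' * r false false)].
Proof.
move=> cB sSA s t s' t'.
have E1 : #|(A :\: S) :&: B| = s'.
  by rewrite /s' /s setIDAC cardsD -setIA (setIC B) setIA (setIidPr sSA).
have E2 : #|(A :\: S) :\: B| = t'.
  rewrite /t' /t setDDl setUC -setDDl cardsD; congr (_ - #|pred_of_set _|).
  by rewrite setIDAC (setIidPr sSA).
split; first by rewrite subset_leq_card // setSI.
- by rewrite subset_leq_card // setSD.
- exact: cardsID.
pose F b := s' * r b true + t' * r b false.
rewrite -[RHS]/(s * F true + t * F false) -sum_by_color /cut; apply: eq_bigr => x xS.
rewrite /F -E1 -E2 -(sum_by_color (A :\: S) B (fun b => r (x \in B) b)).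
apply: eq_bigr => y /setDP[_ yS]; rewrite cB.
by have -> : x != y by apply: contraNneq yS => <-.
Qed.

Lemma greedy_matching k A :
  (forall j B, j < k -> residue j A B -> has_matching 1 B) -> has_matching k A.
Proof.
elim: k => [|k IH] H; first by exists A.
have [B r] : has_matching k A by apply: IH => j B jk; apply: H; apply: ltnW.
exact: has_matching_ext r (H k B (ltnSn k) r).
Qed.

(** * Cubes as matchings with occupied vertices *)

Section Cubes.
Variable n : nat.
Local Notation cube := (cube T n).
Local Notation conf := (discretized_conf e n).
Implicit Types (c d : cube).

Lemma edge_cellP (C : {set T}) :
  reflect (exists x y, e x y /\ C = [set x; y]) (C \in edge_cells e).
Proof.
apply: (iffP imsetP) => [[[x y] exy ->]|[x [y [exy ->]]]].
  by move: exy; rewrite inE /=; exists x, y.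
by exists (x, y); rewrite // inE.
Qed.

Lemma set1_edge x : [set x] \notin edge_cells e.
Proof.
apply/edge_cellP=> -[a [b [eab /setP E]]].
have := E a; have := E b; rewrite !inE !eqxx orbT => /eqP bx /eqP ax.
by move: eab; rewrite ax bx e_irr.
Qed.

Lemma confP c : reflect ((forall i, c i \in graph_cells e) /\
    (forall i j x, x \in c i -> x \in c j -> i = j)) (c \in conf).
Proof.
rewrite inE [_ \in power_cells _ _]inE inE andbC.
apply: (iffP andP) => [[/forallP cells /existsPn dis]|[cells dis]]; split=> //.
- move=> i j x xi xj; apply/eqP; move/existsPn: (dis i) => /(_ j).
  by apply: contraNT => ->; apply/set0Pn; exists x; rewrite inE xi.
- exact/forallP.
- apply/existsPn=> i; apply/existsPn=> j; rewrite negb_and negbK.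
  have [//|ij] := eqVneq i j; rewrite negbK; apply/eqP/setP=> x; rewrite !inE.
  by apply/negP=> /andP[xi xj]; case/eqP: ij; apply: dis xi xj.
Qed.

Lemma cell_cases c i : c \in conf ->
  (exists2 x, c i = [set x] & c i \notin edge_cells e) \/
  (exists x y, [/\ e x y, c i = [set x; y] & c i \in edge_cells e]).
Proof.
case/confP=> /(_ i) + _; rewrite inE => /orP[/imsetP[x _ E]|E].
  by left; exists x; rewrite E ?set1_edge.
by right; case/edge_cellP: (E) => x [y [exy cE]]; exists x, y.
Qed.

Definition singles c := [set v | [exists i, c i == [set v]]].
Definition unused c := [set v | [forall i, v \notin c i]].
(** The vertex factor s is replaced with the edge from s to u. In a cell of the
    space at most one factor is {s}, so no index needs to be named. *)
Definition grow c s u : cube :=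
  [ffun i => if c i == [set s] then [set s; u] else c i].

Lemma singlesP c v : reflect (exists i, c i = [set v]) (v \in singles c).
Proof. by rewrite inE; apply: (iffP existsP) => -[i /eqP]; exists i. Qed.

Lemma unusedP c v : reflect (forall i, v \notin c i) (v \in unused c).
Proof. by rewrite inE; apply: forallP. Qed.

Lemma singles_unused c v : v \in singles c -> v \notin unused c.
Proof.
by move=> /singlesP[i ci]; apply/unusedP => /(_ i); rewrite ci inE eqxx.
Qed.

Section Grow.
Variables (c : cube) (s u : T).
Hypotheses (cc : c \in conf) (sS : s \in singles c) (uU : u \in unused c).
Hypothesis esu : e s u.

Lemma grow_index : exists2 i0, c i0 = [set s] &
  forall i, grow c s u i = if i == i0 then [set s; u] else c i.
Proof.
have [i0 ci0] := singlesP _ _ sS; exists i0 => // i; rewrite ffunE.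
have [->|ni] := eqVneq i i0; first by rewrite ci0 eqxx.
case: eqP => // ci; case/eqP: ni; have [_ dis] := confP _ cc.
by apply: (dis _ _ s); rewrite ?ci ?ci0 inE.
Qed.

Lemma grow_conf : grow c s u \in conf.
Proof.
have [i0 ci0 gE] := grow_index; have [cells dis] := confP _ cc.
have uN i : u \in c i = false by apply/negbTE; move: i; apply/unusedP.
have sN i : s \in c i -> i = i0 by move=> si; apply: (dis _ _ s); rewrite ?ci0 ?inE.
apply/confP; split=> [i|i j x]; rewrite !gE.
  case: eqP => // _; rewrite inE; apply/orP; right.
  by apply/edge_cellP; exists s, u.
case: eqP => [->|ni]; case: eqP => [->|nj] //.
- by rewrite !inE => /orP[/eqP-> /sN->|/eqP->]; rewrite ?uN.
- by rewrite !inE => + /orP[]/eqP xE; rewrite xE ?uN // => /sN.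
- exact: dis.
Qed.

Lemma grow_dim : cube_dim e (grow c s u) = (cube_dim e c).+1.
Proof.
have [i0 ci0 gE] := grow_index; rewrite /cube_dim.
rewrite (_ : [set i | _] = i0 |: [set i | c i \in edge_cells e]).
  by rewrite cardsU1 inE ci0 set1_edge.
apply/setP=> i; rewrite !inE gE; case: eqP => //= _.
by apply/edge_cellP; exists s, u.
Qed.

Lemma grow_face : cube_face c (grow c s u).
Proof.
have [i0 ci0 gE] := grow_index; apply/forallP=> i; rewrite gE.
by case: eqP => // ->; rewrite ci0 sub1set !inE eqxx.
Qed.

Lemma set2_neq1 x : [set s; u] != [set x].
Proof.
apply/eqP=> /setP E; have := E s; have := E u; rewrite !inE !eqxx orbT.
by move=> /esym/eqP ux /esym/eqP sx; move: esu; rewrite ux sx e_irr.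
Qed.

Lemma grow_singles : singles (grow c s u) = singles c :\ s.
Proof.
have [i0 ci0 gE] := grow_index; apply/setP=> v; rewrite in_setD1.
apply/singlesP/andP=> [[i]|[vs /singlesP[i ci]]].
  rewrite gE; case: eqP => [_ /eqP|ni ci]; first by rewrite (negbTE (set2_neq1 v)).
  split; last by apply/singlesP; exists i.
  apply/eqP=> vs; apply: ni; have [_ dis] := confP _ cc.
  by apply: (dis _ _ s); rewrite ?ci ?ci0 ?vs inE.
exists i; rewrite gE; case: eqP => // ii0; move: ci; rewrite ii0 ci0 => /set1_inj sv.
by rewrite sv eqxx in vs.
Qed.

Lemma grow_unused : unused (grow c s u) = unused c :\ u.
Proof.
have [i0 ci0 gE] := grow_index; apply/setP=> v; rewrite in_setD1.
apply/unusedP/andP=> [H|[vu /unusedP H] i].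
  have := H i0; rewrite gE eqxx !inE negb_or => /andP[vs vu]; split=> //.
  apply/forallP=> i; have := H i; rewrite gE; case: eqP => // ->.
  by rewrite ci0 inE.
rewrite gE; case: eqP => // _; rewrite !inE negb_or vu andbT.
by have := H i0; rewrite ci0 inE.
Qed.

End Grow.

Definition links c := [set p : T * T | (p \in setX (singles c) (unused c)) && e p.1 p.2].

Lemma linksP c s u :
  reflect [/\ s \in singles c, u \in unused c & e s u] ((s, u) \in links c).
Proof.
apply: (iffP setIdP) => [[/setXP[sS uU] esu]|[sS uU esu]]; split=> //.
exact/setXP.
Qed.

Lemma card_links c : #|links c| = cut (singles c) (unused c).
Proof.
rewrite /cut /deg pair_big -sum1_card big_mkcond [RHS]big_mkcond /=.
apply: eq_bigr => -[s u] _ /=.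
have -> : ((s, u) \in links c) = [&& s \in singles c, u \in unused c & e s u].
  by apply/linksP/and3P.
by case: (s \in _); case: (u \in _); case: (e s u).
Qed.

Lemma grow_inj c : c \in conf ->
  {in links c &, injective (fun p => grow c p.1 p.2)}.
Proof.
move=> cc [s u] [s' u'] /linksP[sS uU esu] /linksP[sS' uU' esu'] /= E.
have [i0 ci0 gE] := grow_index u cc sS.
have := congr1 (fun d : cube => d i0) E; rewrite gE eqxx ffunE ci0.
case: eqP => [/set1_inj<- /setP|_ /eqP]; last by rewrite (negbTE (set2_neq1 esu s)).
move/(_ u); rewrite !inE eqxx orbT => /esym/orP[]/eqP uE; last by rewrite uE.
by move: esu; rewrite uE e_irr.
Qed.

(** An edge factor of c is already maximal, so it is unchanged in d; hence exactly
    one vertex factor of c becomes an edge, and its new end is free because the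
    factors of d are disjoint. *)
Lemma face_grow c d : c \in conf -> d \in conf ->
  cube_dim e d = (cube_dim e c).+1 -> cube_face c d ->
  exists s u, [/\ s \in singles c, u \in unused c, e s u & d = grow c s u].
Proof.
move=> cc dc dimd /forallP face; have [_ disd] := confP _ dc.
have card2 x y : e x y -> #|[set x; y]| = 2 by move=> /edge_neq; rewrite cards2 => ->.
have edge_eq i : c i \in edge_cells e -> c i = d i.
  case/edge_cellP=> x [y [exy cE]]; apply/eqP; rewrite eqEcard face cE (card2 _ _ exy) /=.
  have [[z ->]|[x' [y' [exy' -> _]]]] := cell_cases i dc; first by rewrite cards1.
  by rewrite (card2 _ _ exy').
pose Ec := [set i | c i \in edge_cells e]; pose Ed := [set i | d i \in edge_cells e].
have sub : Ec \subset Ed.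
  by apply/subsetP=> i; rewrite !inE => H; rewrite -edge_eq.
have /cards1P[i0 E0] : #|Ed :\: Ec| == 1.
  by rewrite cardsD (setIidPr sub) -[#|Ed|]/(cube_dim e d) -[#|Ec|]/(cube_dim e c) dimd subSnn.
have : i0 \in Ed :\: Ec by rewrite E0 set11.
rewrite !inE => /andP[nci0 di0].
have [[s ci0 _]|[x [y [_ _]]]] := cell_cases i0 cc; last by rewrite (negbTE nci0).
have [u [esu di0E]] : exists u, e s u /\ d i0 = [set s; u].
  case/edge_cellP: di0 => x [y [exy dE]]; have := face i0.
  rewrite ci0 sub1set dE !inE => /orP[]/eqP->; first by exists y.
  by exists x; rewrite e_sym setUC.
have other i : i != i0 -> c i = d i.
  move=> ni; have [|nE] := boolP (c i \in edge_cells e); first exact: edge_eq.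
  have nD : d i \notin edge_cells e.
    apply/negP=> dE; case/eqP: ni; apply/set1P; rewrite -E0 !inE dE.
    by rewrite nE.
  have [[x dx _]|[x [y [_ _]]]] := cell_cases i dc; last by rewrite (negbTE nD).
  have [[z cz _]|[x' [y' [_ _]]]] := cell_cases i cc; last by rewrite (negbTE nE).
  by have := face i; rewrite cz dx sub1set inE => /eqP->.
exists s, u; split=> //; first by apply/singlesP; exists i0.
  apply/unusedP=> i; apply/negP=> ui; have [ii0|ni] := eqVneq i i0.
    by move: ui; rewrite ii0 ci0 inE => /eqP us; move: esu; rewrite us e_irr.
  have ud : u \in d i by rewrite -other.
  case/eqP: ni; apply: (disd _ _ u) => //.
  by rewrite di0E !inE eqxx orbT.
apply/ffunP=> i; rewrite ffunE; have [->|ni] := eqVneq i i0; first by rewrite ci0 eqxx.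
rewrite -other //; case: eqP => // ci; case/eqP: ni; apply: (disd _ _ s).
  by apply: (subsetP (face i)); rewrite ci inE.
by rewrite di0E !inE eqxx.
Qed.

Lemma shrink d k : d \in conf -> cube_dim e d = k.+1 -> exists c s u,
  [/\ c \in conf, cube_dim e c = k &
      [/\ s \in singles c, u \in unused c, e s u & d = grow c s u]].
Proof.
move=> dc dimd; have [cells dis] := confP _ dc.
have /card_gt0P[i0] : 0 < #|[set i | d i \in edge_cells e]|.
  by rewrite -[#|_|]/(cube_dim e d) dimd.
rewrite inE => di0; case/edge_cellP: (di0) => x [y [exy dE]].
pose c : cube := [ffun i => if i == i0 then [set x] else d i].
have sub i : c i \subset d i.
  by rewrite ffunE; case: eqP => // ->; rewrite dE sub1set !inE eqxx.
have cc : c \in conf.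
  apply/confP; split=> [i|i j z /(subsetP (sub i)) zi /(subsetP (sub j)) zj].
    by rewrite ffunE; case: eqP => // _; rewrite inE; apply/orP; left; apply: imset_f.
  exact: dis zi zj.
have dimc : cube_dim e d = (cube_dim e c).+1.
  rewrite /cube_dim (_ : [set i | d i \in _] = i0 |: [set i | c i \in edge_cells e]).
    by rewrite cardsU1 inE ffunE eqxx set1_edge.
  by apply/setP=> i; rewrite !inE ffunE; case: eqP => // ->; rewrite di0.
have [|s [u H]] := face_grow cc dc dimc; first exact/forallP.
by exists c, s, u; split=> //; move: dimc; rewrite dimd => -[].
Qed.

Lemma card_singles c : c \in conf -> #|singles c| + cube_dim e c = n.
Proof.
move=> cc; have [_ dis] := confP _ cc.
rewrite -[RHS]card_ord -(cardC [set i | c i \in edge_cells e]) addnC; congr (_ + _).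
rewrite -(card_imset _ set1_inj) -(@card_in_imset _ _ c).
  apply: eq_card => C; apply/imsetP/imsetP=> [[v /singlesP[i ci] ->]|[i]].
    by exists i; rewrite // !inE ci set1_edge.
  rewrite !inE => ni; have [[x ci _]|[x [y [_ _]]]] := cell_cases i cc.
    by move->; exists x => //; apply/singlesP; exists i.
  by rewrite (negbTE ni).
move=> i j _ _ cij.
have [[x ci _]|[x [y [_ ci _]]]] := cell_cases i cc; apply: (dis _ _ x);
by rewrite -?cij ci !inE eqxx.
Qed.

(** By induction on the dimension: every cube of positive dimension is obtained by growing
    a smaller one. *)
Lemma conf_residue c : c \in conf ->
  residue (cube_dim e c) setT (singles c :|: unused c).
Proof.
move: {2}(cube_dim e c) (erefl (cube_dim e c)) => k.
elim: k c => [|k IH] c dimc cc.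
  suff -> : singles c :|: unused c = setT by rewrite dimc.
  apply/setP=> v; rewrite in_setU [RHS]in_setT.
  have [//|vS] := boolP (v \in singles c); apply/unusedP=> i.
  have [[x ci _]|[x [y [_ _ ce]]]] := cell_cases i cc.
    rewrite ci inE; apply: contra vS => /eqP->; apply/singlesP; exists i; exact: ci.
  by move/eqP: dimc; rewrite cards_eq0 => /eqP/setP/(_ i); rewrite !inE ce.
have [c' [s [u [c'c dimc' [sS uU esu ->]]]]] := shrink cc dimc.
rewrite grow_dim // grow_singles // grow_unused //.
have -> : singles c' :\ s :|: unused c' :\ u = (singles c' :|: unused c') :\ s :\ u.
  apply/setP=> v; rewrite !(in_setU, in_setD1).
  have [->|vs] := eqVneq v s; first by rewrite (negbTE (singles_unused sS)) !andbF.
  have [->|//] := eqVneq v u.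
  by rewrite (contraTF (@singles_unused c' u)) ?uU.
have sB : s \in singles c' :|: unused c' by rewrite in_setU sS.
have uB : u \in singles c' :|: unused c' by rewrite in_setU uU orbT.
by rewrite dimc'; apply: residue_rcons; rewrite // -dimc'; apply: IH.
Qed.

(** Cubes are built from a cube of vertices by growing along the edges of the matching. *)
Lemma residue_conf k A S : residue k setT A -> S \subset A -> #|S| + k = n ->
  exists c, [/\ c \in conf, cube_dim e c = k, singles c = S & unused c = A :\: S].
Proof.
elim: k A S => [|k IH] A S r sSA.
  rewrite addn0 => Sn; pose f i := enum_val (cast_ord (esym Sn) i).
  have f_inj : injective f by move=> i j /enum_val_inj/cast_ord_inj.
  have fS i : f i \in S by apply: enum_valP.
  have Sf v : v \in S -> exists i, f i = v.
    move=> vS; exists (cast_ord Sn (enum_rank_in vS v)).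
    by rewrite /f cast_ordK enum_rankK_in.
  exists [ffun i => [set f i]].
  have sE : singles [ffun i => [set f i]] = S.
    apply/setP=> v; apply/singlesP/idP=> [[i]|/Sf[i <-]]; last by exists i; rewrite ffunE.
    by rewrite ffunE => /set1_inj <-.
  split=> //.
  - apply/confP; split=> [i|i j x]; rewrite !ffunE; last by move=> /set1P-> /set1P/f_inj.
    by rewrite inE; apply/orP; left; apply: imset_f.
  - apply/eqP; rewrite cards_eq0; apply/eqP/setP=> i; rewrite !inE ffunE.
    exact/negbTE/set1_edge.
  - apply/setP=> v; rewrite in_setD -(r : setT = A) in_setT andbT.
    apply/unusedP/idP=> [H|vS i].
      by apply/negP=> /Sf[i E]; have := H i; rewrite ffunE E set11.
    by rewrite ffunE inE; apply: contra vS => /eqP->.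
rewrite addnS -addSn; have [B [x [y [rB xB yB exy AE]]]] := residue_last r.
have xS : x \notin S by apply/negP=> /(subsetP sSA); rewrite AE !inE eqxx andbF.
have yS : y \notin S by apply/negP=> /(subsetP sSA); rewrite AE !inE eqxx.
move=> Sn; have [||c [cc dimc sE uE]] := IH B (x |: S) rB.
- rewrite subUset sub1set xB (subset_trans sSA) // AE.
  exact: subset_trans (subD1set _ _) (subD1set _ _).
- by rewrite cardsU1 xS.
have xs : x \in singles c by rewrite sE setU11.
have yu : y \in unused c by rewrite uE !inE negb_or yS yB eq_sym (edge_neq exy).
exists (grow c x y); split.
- exact: grow_conf.
- by rewrite grow_dim // dimc.
- by rewrite grow_singles // sE setU1K.
- rewrite grow_unused // uE AE; apply/setP=> v; rewrite !inE negb_or.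
  by case: (v == x); case: (v == y); case: (v \in S).
Qed.

(** The top-dimensional cofaces of a cube with occupied vertices S correspond to
    the edges from S to the free vertices. *)
Lemma conf_pseudomanifoldP m : 0 < m -> conf_closed_pseudomanifold e n m <->
  [/\ exists A S, [/\ residue m setT A, S \subset A & #|S| + m = n],
      forall k A S, residue k setT A -> S \subset A -> #|S| + k = n -> k <= m
    & forall A S, residue m.-1 setT A -> S \subset A -> #|S| + m.-1 = n ->
        cut S (A :\: S) = 2].
Proof.
move=> m0; have count c : c \in conf -> (cube_dim e c).+1 = m ->
    #|[set d in conf | (cube_dim e d == m) && cube_face c d]| = cut (singles c) (unused c).
  move=> cc dimc; rewrite -card_links -(card_in_imset (grow_inj cc)).
  apply: eq_card => d; apply/setIdP/imsetP=> [[dc /andP[/eqP dimd face]]|[[s u]]].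
    have [|s [u [sS uU esu dE]]] := face_grow cc dc _ face; first by rewrite dimd dimc.
    by exists (s, u) => //; apply/linksP.
  move=> /linksP[sS uU esu] -> /=; split; first exact: grow_conf.
  by rewrite grow_dim // dimc eqxx grow_face.
have splitS c : singles c \subset singles c :|: unused c by apply: subsetUl.
have restS c : (singles c :|: unused c) :\: singles c = unused c.
  apply/setP=> v; rewrite in_setD in_setU; have [|//] := boolP (v \in singles c).
  by move/singles_unused/negbTE->.
split=> [[[c cc dimc] top reg]|[[A [S [r sSA Sn]]] top reg]].
  split.
  - exists (singles c :|: unused c), (singles c).
    rewrite -dimc; split; [exact: conf_residue|exact: splitS|exact: card_singles].
  - move=> k A S r sSA Sn; have [d [dc <- _ _]] := residue_conf r sSA Sn.
    exact: top.
  - move=> A S r sSA Sn; have [d [dc dimd <- <-]] := residue_conf r sSA Sn.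
    have dm : (cube_dim e d).+1 = m by rewrite dimd prednK.
    by rewrite -count // reg.
split.
- by have [c [cc dimc _ _]] := residue_conf r sSA Sn; exists c.
- move=> c cc; apply: (top _ _ _ (conf_residue cc) (splitS c)).
  exact: card_singles.
- move=> c cc dimc; rewrite count // -restS; apply: reg => //.
    by rewrite -dimc; apply: conf_residue.
  by rewrite -dimc; apply: card_singles.
Qed.

End Cubes.
(** * Two-regular graphs as unions of cycles *)

Section Cycles.

(** A permutation s whose orbits, of length at least 3, run along the cycles. *)
Definition cyclic_orientation (s : T -> T) :=
  [/\ injective s, forall x, s (s x) != x
    & forall x y, e x y = (s x == y) || (s y == x)].

Section Orient.
Hypothesis reg : regular 2 setT.

Definition other v w := odflt v [pick x | e w x && (x != v)].

Lemma otherP v w : e w v ->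
  [/\ e w (other v w), other v w != v & forall x, e w x -> x != v -> x = other v w].
Proof.
move=> ewv; have /eqP/cards2P[a [b [ab E]]] : #|[set x in setT | e w x]| = 2.
  by rewrite -deg_card reg.
have nbr x : e w x = (x == a) || (x == b).
  by have /setP/(_ x) := E; rewrite !inE.
rewrite /other; case: pickP => [y /andP[ewy yv]|none] /=.
  split=> // x; move: ewy ewv yv; rewrite !nbr.
  by case/orP=> /eqP-> /orP[]/eqP->; rewrite ?eqxx // => _ /orP[]/eqP->; rewrite ?eqxx.
have := none a; have := none b; rewrite !nbr !eqxx orbT /= => /negbFE/eqP<- /negbFE/eqP ba.
by rewrite ba eqxx in ab.
Qed.

(** One step of a walk: the directed edge from v to w is followed by the one leaving w on
    the other side. Pairs which are not edges are left fixed, so that turn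
    permutes the finite type of all pairs. *)
Definition turn (p : T * T) : T * T :=
  if e p.1 p.2 then (p.2, other p.1 p.2) else p.
Definition reverse (p : T * T) : T * T := (p.2, p.1).

Lemma turn_edge p : e p.1 p.2 -> e (turn p).1 (turn p).2.
Proof. by move=> ep; rewrite /turn ep /=; case: (@otherP p.1 p.2); rewrite // e_sym. Qed.

Lemma turn_reverse_turn p : e p.1 p.2 -> turn (reverse (turn p)) = reverse p.
Proof.
case: p => v w /= evw; rewrite {2}/turn /= evw /reverse /=.
have ewv : e w v by rewrite e_sym.
have [ewo ov _] := otherP ewv; rewrite /turn /= e_sym ewo; congr (_, _).
by have [_ _ /(_ v ewv) <-] := otherP ewo; rewrite // eq_sym.
Qed.

Lemma turn_inj : injective turn.
Proof.
move=> p q; have [ep|np] := boolP (e p.1 p.2); have [eq|nq] := boolP (e q.1 q.2).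
- move=> E; have := turn_reverse_turn ep; rewrite E turn_reverse_turn //.
  by case: p {ep E} => a b; case: q {eq} => c d [-> ->].
- by move=> E; have := turn_edge ep; rewrite E /turn (negbTE nq) (negbTE nq).
- by move=> E; have := turn_edge eq; rewrite -E /turn (negbTE np) (negbTE np).
- by rewrite /turn (negbTE np) (negbTE nq).
Qed.

(** If k + 2 turns reverse p, then k turns reverse the directed edge after p. So a
    walk meeting the reverse of its first edge would meet, midway, an edge that is its own
    reverse or a turn that goes back. *)
Lemma iter_turn_reverse k p : e p.1 p.2 -> iter k turn p <> reverse p.
Proof.
elim/ltn_ind: k p => -[|[|k]] IH p ep.
- by case: p ep => v w /= evw [vw _]; rewrite vw e_irr in evw.
- case: p ep => v w /= evw; rewrite /turn /= evw => -[ov].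
  by have [|_] := @otherP v w; rewrite ?ov ?eqxx // e_sym.
move=> E; apply: (IH k _ (turn p) (turn_edge ep)) => //.
by apply: turn_inj; rewrite turn_reverse_turn // -E iterSr -iterS.
Qed.

(** A walk and its reverse are distinct orbits of turn; the orbit whose root comes
    first in the enumeration is taken as the forward direction. *)
Definition walk_rank p := enum_rank (froot turn p).
Definition forward v w := e v w && (walk_rank (v, w) < walk_rank (w, v)).

Lemma walk_rank_turn p : walk_rank (turn p) = walk_rank p.
Proof.
congr enum_rank; apply/eqP; rewrite (root_connect (fconnect_sym turn_inj)).
by rewrite (fconnect_sym turn_inj) fconnect1.
Qed.

Lemma forward_reverse v w : e v w -> forward w v = ~~ forward v w.
Proof.
move=> evw; have ne : walk_rank (v, w) != walk_rank (w, v).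
  apply/eqP=> /enum_rank_inj/eqP; rewrite (root_connect (fconnect_sym turn_inj)).
  by move/iter_findex; apply: iter_turn_reverse.
rewrite /forward (e_sym w v) evw /= [in RHS]ltn_neqAle (inj_eq val_inj) ne /=.
by rewrite ltnNge.
Qed.

Lemma forward_turn v w : e v w -> forward w (other v w) = forward v w.
Proof.
move=> evw; have := walk_rank_turn (v, w); rewrite {1}/turn /= evw /forward => ->.
have [|-> _ _] := @otherP v w; first by rewrite e_sym.
have := turn_reverse_turn (p := (v, w)) evw; rewrite {2}/turn /= evw /reverse /= => <-.
by rewrite walk_rank_turn.
Qed.

Definition next v := odflt v [pick w | forward v w].

Lemma nextP v : forward v (next v) /\ forall w, forward v w -> w = next v.
Proof.
have unique w w' : forward v w -> forward v w' -> w' = w.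
  move=> fw fw'; apply/eqP; apply/negPn/negP => ww'; have [evw _] := andP fw.
  have evw' : e v w' by case/andP: fw'.
  have [_ _ /(_ w' evw' ww') E] := otherP evw.
  have := @forward_turn w v; rewrite e_sym -E fw' forward_reverse // fw.
  by move/(_ evw).
rewrite /next; case: pickP => [w fw|none] /=; first by split=> // w'; apply: unique.
have [w _ evw] : exists2 w, w \in setT & e v w by apply: deg_gt0P; rewrite reg.
have := @forward_turn w v; rewrite e_sym none forward_reverse // none.
by move/(_ evw).
Qed.

Lemma cyclic_orientation_exists : exists s, cyclic_orientation s.
Proof.
have fE v w : forward v w = (next v == w).
  apply/idP/eqP => [/(proj2 (nextP v)) //|<-]; exact: (proj1 (nextP v)).
have eE v w : e v w = forward v w || forward w v.
  apply/idP/orP => [evw|[/andP[]|/andP[]]] //; last by rewrite e_sym.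
  by rewrite (forward_reverse evw); case: (forward v w); [left|right].
exists next; split.
- move=> x y E; apply/eqP/negPn/negP => xy.
  have fx := proj1 (nextP x); have fy := proj1 (nextP y).
  have ex : e x (next x) by case/andP: fx.
  have ey : e (next x) y by rewrite E e_sym; case/andP: fy.
  have [|_ _ /(_ y ey)] := @otherP x (next x); first by rewrite e_sym.
  rewrite eq_sym => /(_ xy) yE; have := forward_turn ex; rewrite -yE fx.
  by rewrite (forward_reverse (v := y)) 1?e_sym // E fy.
- move=> x; rewrite -fE; have fx := proj1 (nextP x).
  by rewrite forward_reverse ?fx //; case/andP: fx.
- by move=> x y; rewrite eE !fE.
Qed.

End Orient.

Lemma cyclic_orientation_regular s : cyclic_orientation s -> regular 2 setT.
Proof.
case=> s_inj s2 eE v _; rewrite deg_card.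
rewrite (_ : [set w in setT | e v w] = [set s v; finv s v]).
  rewrite cards2; suff -> : s v != finv s v by [].
  by apply: contraNneq (s2 v) => ->; rewrite f_finv.
apply/setP=> w; rewrite !inE eE eq_sym; congr (_ || _).
by apply/eqP/eqP => [<-|->]; rewrite ?finv_f ?f_finv.
Qed.

End Cycles.
End Graph.

Lemma bijective_of_surjective (T1 T2 : finType) (g : T1 -> T2) :
  injective g -> (forall y, exists x, g x = y) -> bijective g.
Proof.
move=> g_inj g_surj; have g_surj' y : exists x, g x == y.
  by have [x <-] := g_surj y; exists x.
have hK y : g (xchoose (g_surj' y)) = y by apply/eqP/(xchooseP (g_surj' y)).
by exists (fun y => xchoose (g_surj' y)) => // x; apply: g_inj; rewrite hK.
Qed.

Definition rotate k (l : 'I_k -> nat) (u : {i : 'I_k & 'I_(l i)}) :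
  {i : 'I_k & 'I_(l i)} := Tagged (fun i => 'I_(l i)) (ordS (tagged u)).

Lemma cycles_rotate k (l : 'I_k -> nat) (u v : {i : 'I_k & 'I_(l i)}) :
  big_disjoint_union (fun i => @cycle_graph (l i)) u v =
  (rotate u == v) || (rotate v == u).
Proof.
case: u v => i x [j y]; rewrite /big_disjoint_union /rotate /=.
have [ij|ij] := eqVneq i j; last first.
  by apply/esym/negbTE/norP; split; apply: contra ij => /eqP/(congr1 tag)/= ->.
by subst j; rewrite tagged_asE !eq_Tagged.
Qed.

Lemma ordS_ordS l (x : 'I_l) : 3 <= l -> ordS (ordS x) != x.
Proof.
move=> l3; apply/eqP=> /(congr1 val) /=; rewrite -addn1 modnDml addn1.
move: (nat_of_ord x) (ltn_ord x) => m ml; clear x.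
case: (ltngtP m.+2 l) => [ml2|lm|l_eq].
- by rewrite modn_small // => E; have := leqnSn m.+1; rewrite E ltnn.
- have l_eq : l = m.+1 by apply/eqP; rewrite eqn_leq ml -ltnS lm.
  rewrite l_eq in l3 *; rewrite -[m.+2]/(1 + m.+1) modnDr modn_small ?(ltnW l3) // => m1.
  by rewrite -m1 in l3.
- by move: l3; rewrite -l_eq modnn; case: (m).
Qed.

(** An orientation yields the cycles as orbits: position j of the cycle through a
    base point is its j-th iterate. *)
Lemma union_of_cyclesP (T : finType) (e : rel T) :
  is_union_of_cycles e <-> (exists x : T, True) /\ exists s, cyclic_orientation e s.
Proof.
split=> [[k [l [k0 l3 [f [g fK gK] fe]]]]|[[x0 _] [s [s_inj s2 eE]]]].
  have rot_inj : injective (@rotate k l).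
    move=> [i x] [j y] E; have ij : i = j by case: E.
    subst j; move/eqP: E; rewrite /rotate /= eq_Tagged => /eqP E.
    by rewrite (bij_inj (@ordS_bij _) E).
  split.
    have lt0 : 0 < l (Ordinal k0) by apply: leq_trans (l3 _).
    by exists (g (Tagged (fun i => 'I_(l i)) (Ordinal lt0))).
  exists (fun x => g (rotate (f x))); split.
  - by move=> x y /(can_inj gK)/rot_inj/(can_inj fK).
  - move=> x; rewrite gK -(inj_eq (can_inj fK)) gK.
    case: (f x) => i y; rewrite /rotate /= eq_Tagged /=; exact: ordS_ordS.
  - by move=> x y; rewrite -fe cycles_rotate -!(inj_eq (can_inj fK)) !gK.
have sC := fconnect_sym s_inj.
pose k := #|froots s|; pose base (i : 'I_k) : T := enum_val i.
have baseE i : froot s (base i) = base i by apply/eqP; exact: (enum_valP i).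
pose l i := order s (base i).
have l0 i : 0 < l i by apply: order_gt0.
have l3 i : 3 <= l i.
  have : iter (l i) s (base i) = base i by apply: iter_order.
  case: (l i) (l0 i) => [|[|[|]]] //= _ E; have := s2 (base i).
    by rewrite E E eqxx.
  by rewrite E eqxx.
pose g (u : {i : 'I_k & 'I_(l i)}) := iter (tagged u) s (base (tag u)).
have g_root u : froot s (g u) = base (tag u).
  by rewrite -[RHS]baseE; apply/eqP; rewrite (root_connect sC) sC; apply: fconnect_iter.
have g_inj : injective g.
  move=> [i x] [j y] E; have ij : i = j.
    by apply: enum_val_inj; rewrite -[LHS](g_root (Tagged _ x)) E g_root.
  subst j; apply/eqP; rewrite eq_Tagged -val_eqE /=.
  rewrite -(findex_iter (ltn_ord x : x < order s (base i))).
  by rewrite -(findex_iter (ltn_ord y : y < order s (base i))) -[iter x _ _]/(g (Tagged _ x)) E.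
have g_surj x : exists u, g u = x.
  have rx : froot s x \in froots s by apply: roots_root.
  pose i : 'I_k := enum_rank_in rx (froot s x).
  have bi : base i = froot s x by rewrite /base enum_rankK_in.
  have con : fconnect s (base i) x by rewrite bi sC connect_root.
  exists (Tagged (fun i => 'I_(l i)) (Ordinal (findex_max con))).
  by rewrite /g /= iter_findex.
have g_rotate u : g (rotate u) = s (g u).
  case: u => i x; rewrite /g /=; have := ltn_ord x; rewrite leq_eqVlt.
  case/predU1P=> [xl|xl]; last by rewrite modn_small.
  by rewrite xl modnn -iterS xl iter_order.
have [f gK fK] := bijective_of_surjective g_inj g_surj.
exists k, l; split=> //.
  by apply/card_gt0P; exists (froot s x0); apply: roots_root.
exists f; first by exists g.
by move=> x y; rewrite cycles_rotate eE -!(inj_eq g_inj) !g_rotate !fK.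
Qed.

(** * Colourings and isomorphism *)

(** List the first class followed by the second one in both types. *)
Lemma bijection_of_cards (T1 T2 : finType) (B1 : {set T1}) (B2 : {set T2}) :
  #|B1| = #|B2| -> #|~: B1| = #|~: B2| ->
  exists2 f : T1 -> T2, bijective f & forall x, (f x \in B2) = (x \in B1).
Proof.
move=> c1 c2; pose L (T : finType) (B : {set T}) := enum B ++ enum (~: B).
have uL (T : finType) (B : {set T}) : uniq (L T B).
  rewrite cat_uniq !enum_uniq andbT; apply/hasPn=> x; rewrite !mem_enum inE.
  by [].
have mL (T : finType) (B : {set T}) x : x \in L T B.
  by rewrite mem_cat !mem_enum inE orbN.
have sL : size (L T1 B1) = size (L T2 B2) by rewrite !size_cat -!cardE c1 c2.
have cT : #|T1| = #|T2| by rewrite -(cardsC B1) -(cardsC B2) c1 c2.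
have [T1_0|T1_gt0] := posnP #|T1|.
  have no1 (x : T1) : False by have := card0_eq T1_0 x; rewrite inE.
  have no2 (y : T2) : False.
    by rewrite cT in T1_0; have := card0_eq T1_0 y; rewrite inE.
  exists (fun x => False_rect T2 (no1 x)); last by move=> x; case: (no1 x).
  by exists (fun y => False_rect T1 (no2 y)) => [x|y]; [case: (no1 x)|case: (no2 y)].
have /card_gt0P[x0 _] := T1_gt0; have /card_gt0P[y0 _] : 0 < #|T2| by rewrite -cT.
pose f x := nth y0 (L T2 B2) (index x (L T1 B1)).
pose g y := nth x0 (L T1 B1) (index y (L T2 B2)).
have fK : cancel f g.
  by move=> x; rewrite /f /g index_uniq // ?nth_index // -sL index_mem.
have gK : cancel g f.
  by move=> x; rewrite /f /g index_uniq // ?nth_index // sL index_mem.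
exists f; first by exists g.
move=> x; rewrite /f nth_cat index_cat mem_enum.
have [xB|xB] := boolP (x \in B1).
  have lt : index x (enum B1) < size (enum B2) by rewrite -cardE -c1 cardE index_mem mem_enum.
  by rewrite lt -mem_enum mem_nth.
rewrite -!cardE c1 ltnNge leq_addr addKn.
have : nth y0 (enum (~: B2)) (index x (enum (~: B1))) \in ~: B2.
  by rewrite -mem_enum mem_nth // -cardE -c2 cardE index_mem mem_enum inE.
by rewrite inE => /negbTE.
Qed.

Lemma graph_iso_colored r (T1 T2 : finType) (e1 : rel T1) (e2 : rel T2) (B2 : {set T2}) :
  colored r e2 B2 -> graph_iso e1 e2 <->
  exists B1 : {set T1}, [/\ colored r e1 B1, #|B1| = #|B2| & #|~: B1| = #|~: B2|].
Proof.
move=> c2; split=> [[f f_bij fe]|[B1 [c1 cB cB']]].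
  have f_inj := bij_inj f_bij.
  have pre (B : {set T2}) : #|f @^-1: B| = #|B|.
    by rewrite on_card_preimset //; apply: onW_bij.
  exists (f @^-1: B2); split; [|exact: pre|by rewrite -preimsetC pre].
  by move=> x y; rewrite -fe c2 !inE (inj_eq f_inj).
have [f f_bij fB] := bijection_of_cards cB cB'.
exists f => // x y; rewrite c2 c1 !fB (inj_eq (bij_inj f_bij)).
by [].
Qed.

Lemma complete_graphP r (T : finType) (e : rel T) :
  graph_iso e (@complete_graph r) <-> colored (fun _ _ => true) e setT /\ #|T| = r.
Proof.
have c : colored (fun _ _ => true) (@complete_graph r) setT.
  by move=> x y; rewrite andbT.
split=> [/(graph_iso_colored e c)[B [cB B1 B2]]|[cT Tr]].
  split; first by move=> x y; rewrite cB.
  by rewrite -(cardsC B) B1 B2 cardsC card_ord.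
apply/(graph_iso_colored e c); exists setT; split=> //.
  by rewrite !cardsT card_ord.
by rewrite !setCT !cards0.
Qed.

Lemma sum_inl_cards (T1 T2 : finType)
    (B := [set u : T1 + T2 | if u is inl _ then true else false]) :
  #|B| = #|T1| /\ #|~: B| = #|T2|.
Proof.
split.
  rewrite -cardsT -(card_imset _ (@inl_inj T1 T2)); apply: eq_card => -[x|y]; rewrite !inE.
    by apply/esym/imsetP; exists x.
  by apply/esym/imsetP=> -[].
rewrite -cardsT -(card_imset _ (@inr_inj T1 T2)); apply: eq_card => -[x|y]; rewrite !inE.
  by apply/esym/imsetP=> -[].
by apply/esym/imsetP; exists y.
Qed.

Lemma complete_bipartiteP a b (T : finType) (e : rel T) :
  graph_iso e (@complete_bipartite a b) <->
  exists B : {set T}, [/\ colored addb e B, #|B| = a & #|~: B| = b].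
Proof.
have [cl cr] := sum_inl_cards 'I_a 'I_b; rewrite !card_ord in cl cr.
have c : colored addb (@complete_bipartite a b)
    [set u : 'I_a + 'I_b | if u is inl _ then true else false].
  by move=> [x|x] [y|y]; rewrite !inE ?andbF.
by rewrite (graph_iso_colored e c) cl cr.
Qed.

Lemma two_complete_graphsP a b (T : finType) (e : rel T) :
  graph_iso e (disjoint_union (@complete_graph a) (@complete_graph b)) <->
  exists B : {set T}, [/\ colored (fun p q => p == q) e B, #|B| = a & #|~: B| = b].
Proof.
have [cl cr] := sum_inl_cards 'I_a 'I_b; rewrite !card_ord in cl cr.
have c : colored (fun p q => p == q) (disjoint_union (@complete_graph a) (@complete_graph b))
    [set u : 'I_a + 'I_b | if u is inl _ then true else false].
  by move=> [x|x] [y|y]; rewrite !inE ?andbF ?andbT.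
by rewrite (graph_iso_colored e c) cl cr.
Qed.
(** * The classification *)

Section Classification.
Variables (T : finType) (e : rel T).
Hypotheses (e_sym : symmetric e) (e_irr : irreflexive e).
Variables (n m : nat).
Hypothesis (m_gt0 : 0 < m).

Definition two_regular_case :=
  residues_are e m.-1 setT (two_regular e) /\ (n = m \/ n + m = #|T|).
Definition single_edge_case :=
  residues_are e m.-1 setT (single_edge_pairings e) /\ (n = m + 1 /\ #|T| = 2 * m + 2).

(** In terms of the sizes s and u of a subset S of a residue and of its complement,
    n = m says that s = 1, and n + m = #|T| says that u = 1. *)
Lemma pseudomanifold_cases : conf_closed_pseudomanifold e n m ->
  two_regular_case \/ single_edge_case.
Proof.
case/(conf_pseudomanifoldP e_sym e_irr n m_gt0) => -[A0 [S0 [r0 sS0 cS0]]] _ reg.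
have cA0 := residue_card e_irr r0; rewrite cardsT in cA0.
have leS0 := subset_leq_card sS0.
have mn : m <= n by rewrite -cS0 leq_addl.
have mN : n + m <= #|T| by rewrite cA0 -cS0; move: leS0; clear; lia.
have exA : has_matching e m.-1 setT.
  case: (m) m_gt0 r0 => // k _ r0.
  by have [B [_ [_ [rB _ _ _ _]]]] := residue_last r0; exists B.
pose s := (n - m).+1; pose u := (#|T| - n - m).+1.
have cA A : residue e m.-1 setT A -> #|A| = s + u.
  move=> r; have := residue_card e_irr r; rewrite cardsT /s /u.
  by move: m_gt0 mn mN; clear; lia.
have bal A : residue e m.-1 setT A -> balanced e s A.
  move=> r S sSA cS; apply: reg r sSA _.
  by rewrite cS /s; move: m_gt0 mn; clear; lia.
have two_reg A : residue e m.-1 setT A -> balanced e 1 A -> two_regular e A.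
  move=> r b1; split; last exact/balanced1.
  by rewrite -card_gt0 (cA _ r).
have [s1|s2] := leqP s 1.
  left; split; last by left; move: s1 mn; rewrite /s; clear; lia.
  split=> // A r; apply: two_reg => //; have := bal A r.
  by have -> : s = 1 by apply/eqP; rewrite eqn_leq s1.
have [u1|u2] := leqP u 1.
  left; split; last by right; move: u1 mN; rewrite /u; clear; lia.
  split=> // A r; apply: two_reg => //; apply: (balanced_compl e_sym _ (bal A r)).
  by rewrite (cA A r); congr (_ + _); apply/eqP; rewrite eqn_leq u1.
right; split; first split=> // A r.
  by have [] := balanced_single_edge e_sym e_irr (cA A r) s2 u2 (bal A r).
have [A r] := exA.
have [+ + _] := balanced_single_edge e_sym e_irr (cA A r) s2 u2 (bal A r).
by move: mn mN; rewrite /s /u; clear; lia.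
Qed.

(** For m = 1 the only residue is the whole graph. *)
Lemma two_regular_case_graphs : two_regular_case ->
  (is_union_of_cycles e /\ (n = 1 \/ n = #|T| - 1) /\ m = 1) \/
  (graph_iso e (@complete_graph (2 * m + 1)) /\ (n = m \/ n = m + 1)) \/
  (graph_iso e (@complete_bipartite (m + 1) (m + 1)) /\ (n = m \/ n = m + 2)).
Proof.
case; case: m m_gt0 => [//|[|k]] _ /= QT nE.
  left; have [_ /(_ _ erefl)[/set0Pn[x _] reg]] := QT.
  split; last by split=> //; case: nE => [->|<-]; [left|right; rewrite addnK].
  apply/union_of_cyclesP; split; first by exists x.
  exact: cyclic_orientation_exists.
right; case: (residues_two_regular e_sym e_irr QT) => [[cl cT]|[ev reg]].
  left; rewrite cardsT in cT; split; last by move: nE; rewrite cT; clear; lia.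
  apply/complete_graphP; split; last by rewrite cT; clear; lia.
  move=> x y; rewrite andbT; have [->|xy] := eqVneq x y; first by rewrite e_irr.
  by apply: cl.
right; have [z [w [_ _ ezw]]] : exists z w, [/\ z \in setT, w \in setT & e z w].
  apply/(has_matching1 e); apply: (has_matching_le _ (residues_are_matching _ QT)) => //.
  exact: two_regular_edge.
have [B [cB B1 B2]] := even_triples_colored e_irr ev ezw.
have cT : #|T| = 2 * k + 6 by rewrite -(cardsC B) B1 B2 !reg ?inE //; clear; lia.
split; last by move: nE; rewrite cT; clear; lia.
by apply/complete_bipartiteP; exists B; rewrite B1 B2 !reg ?inE //; split=> //; clear; lia.
Qed.

(** The degrees allow classes of size m or m + 2 in the bipartite case, and the total
    2 m + 2 forces one of each. In the other case, even degrees make both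
    cliques odd. *)
Lemma single_edge_case_graphs : single_edge_case ->
  (graph_iso e (@complete_bipartite m (m + 2)) /\ n = m + 1) \/
  ((exists p q : nat, [/\ odd p, odd q, p + q = 2 * m + 2
      & graph_iso e (disjoint_union (@complete_graph p) (@complete_graph q))]) /\
     n = m + 1).
Proof.
move=> [QT [nE cT]].
have := quad_even_or_odd e_sym e_irr (residues_single_edge_quad e_sym e_irr QT).
have [z [w [_ _ ezw]]] : exists z w, [/\ z \in setT, w \in setT & e z w].
  apply/(has_matching1 e); apply: (has_matching_le _ (residues_are_matching _ QT)) => //.
  exact: single_edge_pairings_edge.
case=> [ev|od].
  left; split=> //; apply/complete_bipartiteP.
  have [B [cB B1 B2]] := even_triples_colored e_irr ev ezw.
  have := cardsC B; rewrite cT => sumB.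
  have [degz degw] : [\/ #|B| = m | #|B| = m + 2] /\ [\/ #|~: B| = m | #|~: B| = m + 2].
    rewrite B1 B2; split.
      by have := even_residues_deg e_irr QT ev (in_setT z); rewrite prednK // addn2.
    by have := even_residues_deg e_irr QT ev (in_setT w); rewrite prednK // addn2.
  case: degz => Bz; last first.
    exists (~: B); split; [exact: colored_addbC| |by rewrite setCK].
    by move: Bz sumB; clear; lia.
  by exists B; split=> //; move: Bz sumB; clear; lia.
right; split=> //; have [B [cB B1]] := odd_triples_colored e_sym e_irr z od.
have odB : odd #|B|.
  by rewrite B1 /=; apply: (odd_residues_deg e_irr QT od); rewrite inE.
have sumB := cardsC B; exists #|B|, #|~: B|; split=> //.
- have := congr1 odd sumB; rewrite cT oddD odB addn2 /= negbK mul2n odd_double.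
  by case: odd.
- by rewrite sumB.
- by apply/two_complete_graphsP; exists B.
Qed.

(** A cube of dimension m is found by growing one of dimension m - 1 along one of the two
    edges leaving S. *)
Lemma pseudomanifold_of_balanced : m <= n -> n + m <= #|T| ->
  (forall k A, residue e k setT A -> k <= n -> n + k <= #|T| -> k <= m) ->
  has_matching e m.-1 setT ->
  (forall A, residue e m.-1 setT A -> balanced e (n - m.-1) A) ->
  conf_closed_pseudomanifold e n m.
Proof.
move=> mn mN top [A r] bal; apply/(conf_pseudomanifoldP e_sym e_irr n m_gt0).
have reg (A' S : {set T}) : residue e m.-1 setT A' -> S \subset A' -> #|S| + m.-1 = n ->
    cut e S (A' :\: S) = 2.
  by move=> r' sS cS; apply: bal => //; rewrite -cS addnK.
split=> //.
  have cA := residue_card e_irr r; rewrite cardsT in cA.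
  have [|S sSA cS] := @subset_of_card _ A (n - m.-1).
    by move: cA mn mN m_gt0; clear; lia.
  have Sn : #|S| + m.-1 = n by move: cS mn m_gt0; clear; lia.
  have : 0 < cut e S (A :\: S) by rewrite (reg A S).
  rewrite lt0n sum_nat_eq0 negb_forall_in => /exists_inP[x xS].
  rewrite -lt0n => /deg_gt0P[y]; rewrite inE => /andP[yS yA] exy.
  have xA := subsetP sSA x xS.
  exists (A :\ x :\ y), (S :\ x); split.
  - by rewrite -(prednK m_gt0); apply: residue_rcons.
  - apply/subsetP=> v; rewrite !inE => /andP[vx vS].
    by rewrite vx (subsetP sSA v vS) !andbT; apply: contraNneq yS => <-.
  - by rewrite -(prednK m_gt0) addnS -addSn -Sn (cardsD1 x S) xS.
move=> k A' S r' sS Sk; apply: (top k A' r'); first by rewrite -Sk leq_addl.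
have := residue_card e_irr r'; rewrite cardsT => ->.
by have := subset_leq_card sS; move: Sk; clear; lia.
Qed.

Lemma top_dimension k : n = m \/ n + m = #|T| -> k <= n -> n + k <= #|T| -> k <= m.
Proof. by case=> [->//|<- _]; rewrite leq_add2l. Qed.

Lemma cycles_pseudomanifold : is_union_of_cycles e -> 0 < n ->
  n = 1 \/ n = #|T| - 1 -> m = 1 -> conf_closed_pseudomanifold e n m.
Proof.
case/union_of_cyclesP=> -[x0 _] [s /cyclic_orientation_regular reg] n0 nE m1.
have T2 : 2 <= #|T|.
  by rewrite -(reg x0 (in_setT _)) -cardsT deg_le_card.
apply: pseudomanifold_of_balanced; rewrite m1 ?subn0 //.
- by move: nE n0 T2; clear; lia.
- by move=> k A _; rewrite -m1; apply: top_dimension; rewrite m1; move: nE n0 T2; clear; lia.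
- by exists setT.
- move=> A <-; have b1 : balanced e 1 setT by apply/balanced1.
  case: nE => nE; first by rewrite nE.
  by apply: balanced_compl b1; rewrite // cardsT; move: nE n0; clear; lia.
Qed.

(** The residues are triangles. *)
Lemma complete_pseudomanifold : graph_iso e (@complete_graph (2 * m + 1)) ->
  n = m \/ n = m + 1 -> conf_closed_pseudomanifold e n m.
Proof.
case/complete_graphP=> cT sizeT nE.
have adj x y : x != y -> e x y by move=> xy; rewrite cT xy.
apply: pseudomanifold_of_balanced.
- by move: nE; clear; lia.
- by rewrite sizeT; move: nE; clear; lia.
- by move=> k A _; apply: top_dimension; rewrite sizeT; move: nE; clear; lia.
- apply: greedy_matching => j B jm r.
  have /card_gt1P[x [y [xB yB xy]]] : 1 < #|B|.
    by have := residue_card e_irr r; rewrite cardsT sizeT; move: jm; clear; lia.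
  by apply/has_matching1; exists x, y; split=> //; apply: adj.
move=> A r S sSA cS; rewrite (@cut_const _ _ _ _ true); last first.
  by move=> x y xS /setDP[_ yS]; apply: adj; apply: contraNneq yS => <-.
have := residue_card e_irr r; rewrite cardsT sizeT cardsD (setIidPr sSA) cS.
case: nE => ->; move: m_gt0; clear; case: m => // k _ /= E.
  have -> : #|A| = 3 by move: E; clear; lia.
  by rewrite subSnn.
have -> : #|A| = 3 by move: E; clear; lia.
by have -> : k.+1 + 1 - k = 2 by clear; lia.
Qed.

Lemma matching_of_bipartition (B : {set T}) :
  colored addb e B -> m.-1 <= #|B| -> m.-1 <= #|~: B| ->
  has_matching e m.-1 setT.
Proof.
move=> cB B1 B2; apply: greedy_matching => j A jm r.
have [] := residue_addb e_irr cB r; rewrite setTI setTD => E1 E2.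
have /card_gt0P[x] : 0 < #|A :&: B| by move: E1 jm B1; clear; lia.
have /card_gt0P[y] : 0 < #|A :\: B| by move: E2 jm B2; clear; lia.
rewrite !inE => /andP[yB yA] /andP[xA xB].
apply/has_matching1; exists x, y; split=> //; rewrite cB xB (negbTE yB) andbT.
by apply: contraNneq yB => <-.
Qed.

(** The residues are four-cycles. *)
Lemma balanced_bipartite_pseudomanifold :
  graph_iso e (@complete_bipartite (m + 1) (m + 1)) ->
  n = m \/ n = m + 2 -> conf_closed_pseudomanifold e n m.
Proof.
case/complete_bipartiteP=> B [cB B1 B2] nE.
have sizeT : #|T| = 2 * m + 2 by rewrite -(cardsC B) B1 B2; clear; lia.
apply: pseudomanifold_of_balanced.
- by move: nE; clear; lia.
- by rewrite sizeT; move: nE; clear; lia.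
- by move=> k A _; apply: top_dimension; rewrite sizeT; move: nE; clear; lia.
- by apply: matching_of_bipartition cB _ _; rewrite ?B1 ?B2; clear; lia.
move=> A r S sSA cS; have [] := cut_colored cB sSA.
have [] := residue_addb e_irr cB r; rewrite setTI setTD B1 B2 cS => E1 E2.
have -> : #|A :&: B| = 2 by move: E1 m_gt0; clear; lia.
have -> : #|A :\: B| = 2 by move: E2 m_gt0; clear; lia.
move=> + + + ->; have : n - m.-1 = 1 \/ n - m.-1 = 3.
  by case: nE => ->; move: m_gt0; clear; lia.
move=> [] ->; case: #|S :&: B| => [|[|[|i]]] //; by case: #|S :\: B| => [|[|[|j]]].
Qed.

(** The residues are stars K_(1,3), and the smaller class bounds every matching. *)
Lemma unbalanced_bipartite_pseudomanifold :
  graph_iso e (@complete_bipartite m (m + 2)) ->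
  n = m + 1 -> conf_closed_pseudomanifold e n m.
Proof.
case/complete_bipartiteP=> B [cB B1 B2] nE.
have sizeT : #|T| = 2 * m + 2 by rewrite -(cardsC B) B1 B2; clear; lia.
apply: pseudomanifold_of_balanced.
- by rewrite nE; clear; lia.
- by rewrite sizeT nE; clear; lia.
- move=> k A r _ _; have [] := residue_addb e_irr cB r.
  by rewrite setTI B1 => -> _; apply: leq_addl.
- by apply: matching_of_bipartition cB _ _; rewrite ?B1 ?B2; clear; lia.
move=> A r S sSA cS; have [] := cut_colored cB sSA.
have [] := residue_addb e_irr cB r; rewrite setTI setTD B1 B2 cS nE => E1 E2.
have -> : #|A :&: B| = 1 by move: E1 m_gt0; clear; lia.
have -> : #|A :\: B| = 3 by move: E2 m_gt0; clear; lia.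
have -> : m + 1 - m.-1 = 2 by move: m_gt0; clear; lia.
move=> + + + ->.
by case: #|S :&: B| => [|[|i]] //; case: #|S :\: B| => [|[|[|[|j]]]].
Qed.

(** The residues are triangles with an isolated vertex. There is no perfect matching
    because both classes are odd and every edge lies within a class. *)
Lemma two_complete_pseudomanifold p q : odd p -> odd q -> p + q = 2 * m + 2 ->
  graph_iso e (disjoint_union (@complete_graph p) (@complete_graph q)) ->
  n = m + 1 -> conf_closed_pseudomanifold e n m.
Proof.
move=> op oq pq /two_complete_graphsP[B [cB B1 B2]] nE.
have sizeT : #|T| = 2 * m + 2 by rewrite -(cardsC B) B1 B2.
have oddA k A : residue e k setT A -> odd #|A :&: B| /\ odd #|A :\: B|.
  by move=> r; have [] := residue_eqb e_irr cB r; rewrite setTI setTD B1 B2 => <- <-.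
apply: pseudomanifold_of_balanced.
- by rewrite nE; clear; lia.
- by rewrite sizeT nE; clear; lia.
- move=> k A r kn _; have [oA _] := oddA _ _ r; have := residue_card e_irr r.
  rewrite cardsT sizeT -(cardsID B A); move: oA kn; rewrite nE.
  by case: #|A :&: B| => // i _; clear; lia.
- apply: greedy_matching => j A jm r; have := residue_card e_irr r.
  rewrite cardsT sizeT => cA; have [x [y [xA yA xy xyB]]] : exists x y,
      [/\ x \in A, y \in A, x != y & (x \in B) == (y \in B)].
    have [/card_gt1P[x [y [+ + xy]]]|le1] := ltnP 1 #|A :&: B|.
      by rewrite !inE => /andP[xA xB] /andP[yA yB]; exists x, y; rewrite xB yB.
    have /card_gt1P[x [y [+ + xy]]] : 1 < #|A :\: B|.
      by move: le1 jm cA; rewrite -(cardsID B A); clear; lia.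
    rewrite !inE => /andP[xB xA] /andP[yB yA]; exists x, y.
    by rewrite (negbTE xB) (negbTE yB).
  by apply/has_matching1; exists x, y; rewrite cB xy.
move=> A r S sSA cS; have [] := cut_colored cB sSA; rewrite cS nE.
have -> : m + 1 - m.-1 = 2 by move: m_gt0; clear; lia.
have [] := oddA _ _ r; have : #|A :&: B| + #|A :\: B| = 4.
  rewrite cardsID; have := residue_card e_irr r; rewrite cardsT sizeT.
  by move: m_gt0; clear; lia.
move=> + + + + + + ->; clear.
case: #|A :&: B| => [|[|[|[|[|i]]]]] //; case: #|A :\: B| => [|[|[|[|[|j]]]]] //=;
by case: #|S :&: B| => [|[|[|[|k]]]] //; case: #|S :\: B| => [|[|[|[|l]]]].
Qed.

End Classification.

Theorem theorem1p4 (T : finType) (e : rel T)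
    (e_sym : symmetric e) (e_irr : irreflexive e)
    (n m : nat) (n_gt0 : 0 < n) (m_gt0 : 0 < m) :
  conf_closed_pseudomanifold e n m <->
  ((is_union_of_cycles e /\ (n = 1 \/ n = #|T| - 1) /\ m = 1) \/
   (graph_iso e (@complete_graph (2 * m + 1)) /\ (n = m \/ n = m + 1)) \/
   (graph_iso e (@complete_bipartite (m + 1) (m + 1)) /\
      (n = m \/ n = m + 2)) \/
   (graph_iso e (@complete_bipartite m (m + 2)) /\ n = m + 1) \/
   ((exists p q : nat,
       [/\ odd p, odd q, p + q = 2 * m + 2
         & graph_iso e
             (disjoint_union (@complete_graph p) (@complete_graph q))]) /\
      n = m + 1)).
Proof.
split.
  case/(pseudomanifold_cases e_sym e_irr m_gt0).
    move/(two_regular_case_graphs e_sym e_irr m_gt0).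
    by case=> [?|[?|?]]; [left|right; left|do 2!right; left].
  move/(single_edge_case_graphs e_sym e_irr m_gt0).
  by case=> ?; [do 3!right; left|do 4!right].
case=> [[cyc [nE m1]]|[[iso nE]|[[iso nE]|[[iso nE]|[[p [q [op oq pq iso]]] nE]]]]].
- exact: cycles_pseudomanifold.
- exact: complete_pseudomanifold.
- exact: balanced_bipartite_pseudomanifold.
- exact: unbalanced_bipartite_pseudomanifold.
- exact: (two_complete_pseudomanifold e_sym e_irr m_gt0 op oq).
Qed.
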